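(* Let $\mathbf k$ be a field of characteristic zero. Every modular operad $P$ in complexes of $\mathbf k$-vector spaces has a minimal model, i.e. there exist a minimal modular operad $P_\infty$ and a weak equivalence of modular operads $P_\infty\to P$.
   Context: Complexes have differential of degree $-1$, with Koszul signs. A modular $\Sigma$-module is a family $E((g,l))$, $g,l\ge0$, $2g-2+l>0$, of complexes with right $\Sigma_l$-actions. A (dg) modular operad (Getzler–Kapranov) is a modular $\Sigma$-module $P$ with compositions $\circ_i:P((g,l))\otimes P((h,m))\to P((g+h,l+m-2))$, $1\le i\le l$, and contractions $\xi_{ij}:P((g,l))\to P((g+1,l-2))$, $i\ne j$, satisfying the usual axioms of associativity, commutativity, equivariance and compatibility (no units). A weak equivalence is a morphism that is a homology isomorphism for every $(g,l)$. The modular dimension is $d(g,l)=3g-3+l$, and $E_n=(E((g,l)))_{d(g,l)=n}$. An $n$-truncated modular operad is a modular operad defined only for $(g,l)$ with $d(g,l)\le n$, with those operations and axioms that make sense; $t_n$ denotes truncation from modular operads to $n$-truncated ones, and $t_!$ its left adjoint. The adjunction gives natural maps $t_!t_{n-1}P\to t_!t_nP$; the sequence $0\to t_!t_0P\to\cdots\to t_!t_{n-1}P\to t_!t_nP\to\cdots$ is the canonical tower of $P$. Principal extensions. For a complex $A$, $A[-1]_i=A_{i+1}$ with differential $-d_A$. Given a modular operad $P$, a modular $\Sigma$-module $V$ with zero differential concentrated in modular dimension $n$, and a chain map of modular $\Sigma$-modules $\xi:V[-1]\to P_n$, the principal extension $P\sqcup_\xi V$ is the modular operad representing the functor sending $Q$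 to the set of pairs $(f,g)$ with $f:P\to Q$ a morphism of modular operads and $g:V\to Q$ a degree $0$ homogeneous equivariant map (not necessarily a chain map) with $d_Qg=f\xi$. A modular operad $M$ is minimal if its canonical tower is a sequence of principal extensions, i.e. each $t_!t_{n-1}M\to t_!t_nM$ ($n\ge0$, with $t_!t_{-1}M=0$) is a principal extension by some $V$ concentrated in modular dimension $n$ with zero differential. *)

(* Defs.v *)
From HB Require Import structures.
From mathcomp Require Import all_boot all_order all_fingroup all_algebra.

Set Implicit Arguments.
Unset Strict Implicit.
Unset Printing Implicit Defensive.

Import Order.TTheory GRing.Theory Num.Theory.
Local Open Scope ring_scope.

(* Structure maps take their target index or target degree as an argument,
   together with the equation relating it to the source ([p = q + 1] for the
   differential, [p + q = r] and [gluable a b c] for a composition), so that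
   no transport along equalities of indices is needed. *)

Record complex (k : fieldType) := Complex {
  cobj :> int -> lmodType k;
  cdiff : forall p q : int, p = q + 1 -> cobj p -> cobj q;
  cdiff_linear : forall (p q : int) (e : p = q + 1), linear (cdiff e);
  cdiffK : forall (p q r : int) (e : p = q + 1) (e' : q = r + 1) (x : cobj p),
    cdiff e' (cdiff e x) = 0
}.
Arguments cdiff {k} c {p q}.

HB.instance Definition _ (k : fieldType) (C : complex k) (p q : int)
  (e : p = q + 1) :=
  GRing.isLinear.Build k (C p) (C q) _ (cdiff C e) (cdiff_linear e).

Lemma shift_eq (p q : int) : p = q + 1 -> p + 1 = q + 1 + 1.
Proof. by move=> ->. Qed.

Definition shift_diff (k : fieldType) (C : complex k) (p q : int)
  (e : p = q + 1) (x : C (p + 1)) : C (q + 1) := - cdiff C (shift_eq e) x.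

Lemma shift_diff_linear (k : fieldType) (C : complex k) (p q : int)
  (e : p = q + 1) : linear (@shift_diff k C p q e).
Proof. by move=> t x y; rewrite /shift_diff linearP opprD scalerN. Qed.

Lemma shift_diffK (k : fieldType) (C : complex k) (p q r : int)
  (e : p = q + 1) (e' : q = r + 1) (x : C (p + 1)) :
  shift_diff e' (shift_diff e x) = 0.
Proof. by rewrite /shift_diff linearN /= cdiffK !oppr0. Qed.

(* C[-1], with C[-1]_p = C_(p+1). *)
Definition shift (k : fieldType) (C : complex k) : complex k :=
  @Complex k (fun p => C (p + 1)) (@shift_diff k C)
    (@shift_diff_linear k C) (@shift_diffK k C).

(* The stable pairs (g, l), i.e. those with 2g - 2 + l > 0. *)
Definition mindex : Type := {gl : nat * nat | (2 < 2 * gl.1 + gl.2)%N}.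

Definition moddim (a : mindex) : int :=
  3 * (val a).1%:Z - 3 + (val a).2%:Z.

(* Modular Sigma-modules and modular operads are defined over an arbitrary set
   [D] of stable pairs; [full], [upto n] and [ofdim n] give respectively the
   untruncated notions, the n-truncated ones, and the families E_n. *)
Definition full : pred mindex := predT.
Definition upto (n : int) : pred mindex := fun a => moddim a <= n.
Definition ofdim (n : int) : pred mindex := fun a => moddim a == n.

Definition idx (D : pred mindex) : Type := {a : mindex | D a}.
Definition genus (D : pred mindex) (a : idx D) : nat := (val (val a)).1.
Definition legs (D : pred mindex) (a : idx D) : nat := (val (val a)).2.

Definition to_full (D : pred mindex) (a : idx D) : idx full :=
  exist (fun b => full b) (val a) isT.

Lemma upto_pred (n : int) (a : mindex) : upto (n - 1) a -> upto n a.
Proof. by rewrite /upto => /le_trans; apply; rewrite gerBl. Qed.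

Definition widen_idx (n : int) (a : idx (upto (n - 1))) : idx (upto n) :=
  exist (fun b => upto n b) (val a) (upto_pred (valP a)).

(* In {perm 'I_l} one has (s * t) i = t (s i), so a right action is a
   relabelling: leg [i] of [x] becomes leg [s i] of [sact s x]. *)
Record smodule (k : fieldType) (D : pred mindex) := SModule {
  sobj :> idx D -> complex k;
  sact : forall (a : idx D) (p : int),
    {perm 'I_(legs a)} -> sobj a p -> sobj a p;
  sact_linear : forall (a : idx D) (p : int) (s : {perm 'I_(legs a)}),
    linear (@sact a p s);
  sact1 : forall (a : idx D) (p : int) (x : sobj a p), sact 1%g x = x;
  sactM : forall (a : idx D) (p : int) (s t : {perm 'I_(legs a)})
    (x : sobj a p), sact (s * t)%g x = sact t (sact s x);
  sact_diff : forall (a : idx D) (p q : int) (e : p = q + 1)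
    (s : {perm 'I_(legs a)}) (x : sobj a p),
    cdiff (sobj a) e (sact s x) = sact s (cdiff (sobj a) e x)
}.
Arguments sact {k D} E {a p} s x : rename.

HB.instance Definition _ (k : fieldType) (D : pred mindex) (E : smodule k D)
  (a : idx D) (p : int) (s : {perm 'I_(legs a)}) :=
  GRing.isLinear.Build k (E a p) (E a p) _ (@sact k D E a p s)
    (sact_linear s).

Lemma sshift_act_diff (k : fieldType) (D : pred mindex) (E : smodule k D)
  (a : idx D) (p q : int) (e : p = q + 1) (s : {perm 'I_(legs a)})
  (x : shift (E a) p) :
  cdiff (shift (E a)) e (sact E s x : shift (E a) p) =
  sact E s (cdiff (shift (E a)) e x).
Proof. by rewrite /= /shift_diff sact_diff linearN. Qed.

Definition sshift (k : fieldType) (D : pred mindex) (E : smodule k D) :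
  smodule k D :=
  @SModule k D (fun a => shift (E a)) (fun a p s => @sact k D E a (p + 1) s)
    (fun a p s => @sact_linear k D E a (p + 1) s)
    (fun a p x => @sact1 k D E a (p + 1) x)
    (fun a p s t x => @sactM k D E a (p + 1) s t x)
    (@sshift_act_diff k D E).

Definition srestrict (k : fieldType) (D : pred mindex) (E : smodule k full) :
  smodule k D :=
  @SModule k D (fun a => E (to_full a))
    (fun a p => @sact k full E (to_full a) p)
    (fun a p => @sact_linear k full E (to_full a) p)
    (fun a p => @sact1 k full E (to_full a) p)
    (fun a p => @sactM k full E (to_full a) p)
    (fun a p q e => @sact_diff k full E (to_full a) p q e).

Definition zero_diff (k : fieldType) (D : pred mindex) (E : smodule k D) :
  Prop :=
  forall (a : idx D) (p q : int) (e : p = q + 1) (x : E a p),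
    cdiff (E a) e x = 0.

(* Degree 0 homogeneous equivariant maps, not necessarily chain maps. *)
Record gmap (k : fieldType) (D : pred mindex) (E F : smodule k D) := GMap {
  gmap_fun :> forall (a : idx D) (p : int), E a p -> F a p;
  gmap_linear : forall (a : idx D) (p : int), linear (@gmap_fun a p);
  gmap_act : forall (a : idx D) (p : int) (s : {perm 'I_(legs a)})
    (x : E a p), gmap_fun (sact E s x) = sact F s (gmap_fun x)
}.
Arguments gmap_fun {k D E F} g a p.

HB.instance Definition _ (k : fieldType) (D : pred mindex) (E F : smodule k D)
  (f : gmap E F) (a : idx D) (p : int) :=
  GRing.isLinear.Build k (E a p) (F a p) _ (@gmap_fun k D E F f a p)
    (gmap_linear f (p := p)).

Record shom (k : fieldType) (D : pred mindex) (E F : smodule k D) := SHom {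
  shom_gmap :> gmap E F;
  shom_diff : forall (a : idx D) (p q : int) (e : p = q + 1) (x : E a p),
    cdiff (F a) e (shom_gmap a p x) = shom_gmap a q (cdiff (E a) e x)
}.

Definition gluable (D : pred mindex) (a b c : idx D) : bool :=
  [&& genus c == genus a + genus b, 0 < legs b & legs c + 2 == legs a + legs b]%N.

Definition contractible (D : pred mindex) (a c : idx D) : bool :=
  ((genus c == (genus a).+1) && (legs c + 2 == legs a))%N.

(* Numbering of the legs, from 0.  In [x o_i y], leg [i] of [x] is glued to
   leg 0 of [y], and the remaining legs of [y] are inserted, in order, in place
   of leg [i] of [x]: [lleg i m u] is the new number of the leg [u != i] of [x]
   ([m] being the number of legs of [y]), and [rleg i v] that of the leg
   [v != 0] of [y].  In [xi_ij x], the legs [u != i, j] keep their order and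
   [cleg i j u] is the new number of [u]. *)
Definition lleg (i m u : nat) : nat :=
  (if u < i then u else u + m - 2)%N.
Definition rleg (i v : nat) : nat := (i + v - 1)%N.
Definition cleg (i j u : nat) : nat := (u - (i < u) - (j < u))%N.

Record modop (k : fieldType) (D : pred mindex) := ModOp {
  mo_smodule :> smodule k D;
  mcomp : forall (a b c : idx D), gluable a b c -> 'I_(legs a) ->
    forall p q r : int, p + q = r ->
    mo_smodule a p -> mo_smodule b q -> mo_smodule c r;
  mcontr : forall (a c : idx D), contractible a c ->
    forall i j : 'I_(legs a), i != j ->
    forall p : int, mo_smodule a p -> mo_smodule c p;

  (* A map out of a tensor product of complexes is given as a bilinear map; it
     is a chain map by the Leibniz rule [mcomp_diff]. *)
  mcomp_linearl : forall (a b c : idx D) (e : gluable a b c) (i : 'I_(legs a))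
    (p q r : int) (d : p + q = r) (y : mo_smodule b q),
    linear (fun x => mcomp e i d x y);
  mcomp_linearr : forall (a b c : idx D) (e : gluable a b c) (i : 'I_(legs a))
    (p q r : int) (d : p + q = r) (x : mo_smodule a p),
    linear (mcomp e i d x);
  mcomp_diff : forall (a b c : idx D) (e : gluable a b c) (i : 'I_(legs a))
    (p q r p' q' r' : int) (d : p + q = r)
    (ex : p = p' + 1) (ey : q = q' + 1) (ez : r = r' + 1)
    (dl : p' + q = r') (dr : p + q' = r')
    (x : mo_smodule a p) (y : mo_smodule b q),
    cdiff (mo_smodule c) ez (mcomp e i d x y) =
      mcomp e i dl (cdiff (mo_smodule a) ex x) y
      + (-1) ^ p *: mcomp e i dr x (cdiff (mo_smodule b) ey y);

  mcontr_linear : forall (a c : idx D) (e : contractible a c)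
    (i j : 'I_(legs a)) (ij : i != j) (p : int), linear (@mcontr a c e i j ij p);
  mcontr_diff : forall (a c : idx D) (e : contractible a c)
    (i j : 'I_(legs a)) (ij : i != j) (p q : int) (ep : p = q + 1)
    (x : mo_smodule a p),
    cdiff (mo_smodule c) ep (mcontr e ij x) =
    mcontr e ij (cdiff (mo_smodule a) ep x);

  (* Here and below, [w] is the bijection induced on the remaining legs. *)
  mcomp_act : forall (a b c : idx D) (e : gluable a b c) (i : 'I_(legs a))
    (p q r : int) (d : p + q = r) (x : mo_smodule a p) (y : mo_smodule b q)
    (s : {perm 'I_(legs a)}) (t : {perm 'I_(legs b)}) (w : {perm 'I_(legs c)}),
    (forall v : 'I_(legs b), val v = 0%N -> val (t v) = 0%N) ->
    (forall u (u' : 'I_(legs c)), u != i -> val u' = lleg i (legs b) u ->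
       val (w u') = lleg (s i) (legs b) (s u)) ->
    (forall (v : 'I_(legs b)) (v' : 'I_(legs c)), val v != 0%N -> val v' = rleg i v ->
       val (w v') = rleg (s i) (t v)) ->
    mcomp e (s i) d (sact mo_smodule s x) (sact mo_smodule t y) =
    sact mo_smodule w (mcomp e i d x y);
  mcontr_act : forall (a c : idx D) (e : contractible a c)
    (i j : 'I_(legs a)) (p : int) (x : mo_smodule a p)
    (s : {perm 'I_(legs a)}) (w : {perm 'I_(legs c)})
    (ij : i != j) (sij : s i != s j),
    (forall u (u' : 'I_(legs c)), u != i -> u != j -> val u' = cleg i j u ->
       val (w u') = cleg (s i) (s j) (s u)) ->
    mcontr e sij (sact mo_smodule s x) = sact mo_smodule w (mcontr e ij x);

  (* Commutativity: [x o_i y] and [y o_0 x] agree up to the Koszul sign, once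
     leg [i] of [x] has been moved to position 0 by [s]. *)
  mcomp_comm : forall (a b c : idx D) (e : gluable a b c) (e' : gluable b a c)
    (i : 'I_(legs a)) (j : 'I_(legs b))
    (p q r : int) (d : p + q = r) (d' : q + p = r)
    (x : mo_smodule a p) (y : mo_smodule b q)
    (s : {perm 'I_(legs a)}) (w : {perm 'I_(legs c)}),
    val j = 0%N -> val (s i) = 0%N ->
    (forall u (u' : 'I_(legs c)), u != i -> val u' = lleg i (legs b) u ->
       val (w u') = rleg 0 (s u)) ->
    (forall (v : 'I_(legs b)) (v' : 'I_(legs c)),
       val v != 0%N -> val v' = rleg i v ->
       val (w v') = lleg 0 (legs a) v) ->
    sact mo_smodule w (mcomp e i d x y) =
    (-1) ^ (p * q) *: mcomp e' j d' y (sact mo_smodule s x);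
  mcontr_sym : forall (a c : idx D) (e : contractible a c)
    (i j : 'I_(legs a)) (ij : i != j) (ji : j != i) (p : int)
    (x : mo_smodule a p), mcontr e ij x = mcontr e ji x;

  mcomp_seq : forall (a b c ab bc abc : idx D)
    (e1 : gluable a b ab) (e2 : gluable ab c abc)
    (e3 : gluable b c bc) (e4 : gluable a bc abc)
    (i : 'I_(legs a)) (v : 'I_(legs b)) (v' : 'I_(legs ab))
    (p q r pq qr pqr : int) (d1 : p + q = pq) (d2 : pq + r = pqr)
    (d3 : q + r = qr) (d4 : p + qr = pqr)
    (x : mo_smodule a p) (y : mo_smodule b q) (z : mo_smodule c r),
    val v != 0%N -> val v' = rleg i v ->
    mcomp e2 v' d2 (mcomp e1 i d1 x y) z =
    mcomp e4 i d4 x (mcomp e3 v d3 y z);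
  mcomp_par : forall (a b c ab ac abc : idx D)
    (e1 : gluable a b ab) (e2 : gluable ab c abc)
    (e3 : gluable a c ac) (e4 : gluable ac b abc)
    (i j : 'I_(legs a)) (j' : 'I_(legs ab)) (i' : 'I_(legs ac))
    (p q r pq pr pqr : int) (d1 : p + q = pq) (d2 : pq + r = pqr)
    (d3 : p + r = pr) (d4 : pr + q = pqr)
    (x : mo_smodule a p) (y : mo_smodule b q) (z : mo_smodule c r),
    i != j -> val j' = lleg i (legs b) j -> val i' = lleg j (legs c) i ->
    mcomp e2 j' d2 (mcomp e1 i d1 x y) z =
    (-1) ^ (q * r) *: mcomp e4 i' d4 (mcomp e3 j d3 x z) y;

  mcontr_contr : forall (a b b' c : idx D)
    (e1 : contractible a b) (e2 : contractible b c)
    (e3 : contractible a b') (e4 : contractible b' c)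
    (i j m n : 'I_(legs a)) (m' n' : 'I_(legs b)) (i' j' : 'I_(legs b'))
    (ij : i != j) (mn : m != n) (mn' : m' != n') (ij' : i' != j')
    (p : int) (x : mo_smodule a p),
    m != i -> m != j -> n != i -> n != j ->
    val m' = cleg i j m -> val n' = cleg i j n ->
    val i' = cleg m n i -> val j' = cleg m n j ->
    mcontr e2 mn' (mcontr e1 ij x) = mcontr e4 ij' (mcontr e3 mn x);
  mcontr_compl : forall (a b c a' c' : idx D)
    (e1 : gluable a b c) (e2 : contractible c c')
    (e3 : contractible a a') (e4 : gluable a' b c')
    (i m n : 'I_(legs a)) (m' n' : 'I_(legs c)) (i' : 'I_(legs a'))
    (mn : m != n) (mn' : m' != n')
    (p q r : int) (d : p + q = r) (x : mo_smodule a p) (y : mo_smodule b q),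
    m != i -> n != i ->
    val m' = lleg i (legs b) m -> val n' = lleg i (legs b) n ->
    val i' = cleg m n i ->
    mcontr e2 mn' (mcomp e1 i d x y) = mcomp e4 i' d (mcontr e3 mn x) y;
  mcontr_compr : forall (a b c b' c' : idx D)
    (e1 : gluable a b c) (e2 : contractible c c')
    (e3 : contractible b b') (e4 : gluable a b' c')
    (i : 'I_(legs a)) (m n : 'I_(legs b)) (m' n' : 'I_(legs c))
    (mn : m != n) (mn' : m' != n')
    (p q r : int) (d : p + q = r) (x : mo_smodule a p) (y : mo_smodule b q),
    val m != 0%N -> val n != 0%N ->
    val m' = rleg i m -> val n' = rleg i n ->
    mcontr e2 mn' (mcomp e1 i d x y) = mcomp e4 i d x (mcontr e3 mn y);

  (* Gluing first (i, 0) and then (m, n), or first (m, n) and then (i, 0);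
     [t] moves leg [n] of [y] to position 0, leg 0 to position [val (t o)]. *)
  mcontr_compm : forall (a b c c' : idx D)
    (e1 : gluable a b c) (e2 : contractible c c')
    (i m : 'I_(legs a)) (o n : 'I_(legs b)) (t : {perm 'I_(legs b)})
    (m' n' i' o' : 'I_(legs c)) (mn' : m' != n') (io' : i' != o')
    (w : {perm 'I_(legs c')})
    (p q r : int) (d : p + q = r) (x : mo_smodule a p) (y : mo_smodule b q),
    m != i -> val o = 0%N -> n != o -> val (t n) = 0%N ->
    val m' = lleg i (legs b) m -> val n' = rleg i n ->
    val i' = lleg m (legs b) i -> val o' = rleg m (t o) ->
    (forall u (u' : 'I_(legs c')), u != i -> u != m ->
       val u' = cleg m' n' (lleg i (legs b) u) ->
       val (w u') = cleg i' o' (lleg m (legs b) u)) ->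
    (forall v (v' : 'I_(legs c')), v != o -> v != n ->
       val v' = cleg m' n' (rleg i v) ->
       val (w v') = cleg i' o' (rleg m (t v))) ->
    sact mo_smodule w (mcontr e2 mn' (mcomp e1 i d x y)) =
    mcontr e2 io' (mcomp e1 m d x (sact mo_smodule t y))
}.
Arguments mcomp {k D} P {a b c} e i {p q r} d x y : rename.
Arguments mcontr {k D} P {a c} e {i j} ij {p} x : rename.

HB.instance Definition _ (k : fieldType) (D : pred mindex) (P : modop k D)
  (a b c : idx D) (e : gluable a b c) (i : 'I_(legs a)) (p q r : int)
  (d : p + q = r) (x : P a p) :=
  GRing.isLinear.Build k (P b q) (P c r) _ (mcomp P e i d x)
    (mcomp_linearr e i d x).

HB.instance Definition _ (k : fieldType) (D : pred mindex) (P : modop k D)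
  (a c : idx D) (e : contractible a c) (i j : 'I_(legs a)) (ij : i != j)
  (p : int) :=
  GRing.isLinear.Build k (P a p) (P c p) _ (@mcontr k D P a c e i j ij p)
    (mcontr_linear e ij (p := p)).

Record mohom (k : fieldType) (D : pred mindex) (P Q : modop k D) := MOHom {
  mohom_shom :> shom P Q;
  mohom_comp : forall (a b c : idx D) (e : gluable a b c) (i : 'I_(legs a))
    (p q r : int) (d : p + q = r) (x : P a p) (y : P b q),
    mohom_shom c r (mcomp P e i d x y) =
    mcomp Q e i d (mohom_shom a p x) (mohom_shom b q y);
  mohom_contr : forall (a c : idx D) (e : contractible a c)
    (i j : 'I_(legs a)) (ij : i != j) (p : int) (x : P a p),
    mohom_shom c p (mcontr P e ij x) = mcontr Q e ij (mohom_shom a p x)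
}.

Definition restrict (k : fieldType) (D : pred mindex) (P : modop k full) :
  modop k D :=
  let F := @to_full D in
  @ModOp k D (srestrict D P)
    (fun a b c => @mcomp k full P (F a) (F b) (F c))
    (fun a c => @mcontr k full P (F a) (F c))
    (fun a b c => @mcomp_linearl k full P (F a) (F b) (F c))
    (fun a b c => @mcomp_linearr k full P (F a) (F b) (F c))
    (fun a b c => @mcomp_diff k full P (F a) (F b) (F c))
    (fun a c => @mcontr_linear k full P (F a) (F c))
    (fun a c => @mcontr_diff k full P (F a) (F c))
    (fun a b c => @mcomp_act k full P (F a) (F b) (F c))
    (fun a c => @mcontr_act k full P (F a) (F c))
    (fun a b c => @mcomp_comm k full P (F a) (F b) (F c))
    (fun a c => @mcontr_sym k full P (F a) (F c))
    (fun a b c ab bc abc =>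
       @mcomp_seq k full P (F a) (F b) (F c) (F ab) (F bc) (F abc))
    (fun a b c ab ac abc =>
       @mcomp_par k full P (F a) (F b) (F c) (F ab) (F ac) (F abc))
    (fun a b b' c => @mcontr_contr k full P (F a) (F b) (F b') (F c))
    (fun a b c a' c' =>
       @mcontr_compl k full P (F a) (F b) (F c) (F a') (F c'))
    (fun a b c b' c' =>
       @mcontr_compr k full P (F a) (F b) (F c) (F b') (F c'))
    (fun a b c c' => @mcontr_compm k full P (F a) (F b) (F c) (F c')).

(* t_n.  For n < 0 there is no stable pair of modular dimension at most n, so
   [trunc n P] has no component. *)
Definition trunc (k : fieldType) (n : int) (P : modop k full) :
  modop k (upto n) := restrict (upto n) P.

(* [eta] is a universal arrow from t_n P to the functor t_n, i.e. it exhibits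
   [T] as the value t_! t_n P of the left adjoint of t_n, with [eta] the unit
   of the adjunction.  For n = -1 it says that [T] is initial, i.e. zero. *)
Definition is_tshriek (k : fieldType) (n : int) (P T : modop k full)
  (eta : mohom (trunc n P) (trunc n T)) : Prop :=
  forall (Q : modop k full) (f : mohom (trunc n P) (trunc n Q)),
  exists2 h : mohom T Q,
    forall (a : idx (upto n)) (p : int) (x : P (to_full a) p),
      h (to_full a) p (eta a p x) = f a p x
  & forall h' : mohom T Q,
    (forall (a : idx (upto n)) (p : int) (x : P (to_full a) p),
      h' (to_full a) p (eta a p x) = f a p x) ->
    forall (a : idx full) (p : int) (x : T a p), h' a p x = h a p x.

(* [j] is the natural map t_! t_(n-1) P -> t_! t_n P, i.e. the one
   corresponding by adjunction to t_(n-1) of the unit t_n P -> t_n t_! t_n P. *)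
Definition is_tower_map (k : fieldType) (n : int) (P A B : modop k full)
  (etaA : mohom (trunc (n - 1) P) (trunc (n - 1) A))
  (etaB : mohom (trunc n P) (trunc n B)) (j : mohom A B) : Prop :=
  forall (a : idx (upto (n - 1))) (p : int) (x : P (to_full a) p),
    j (to_full a) p (etaA a p x) = etaB (widen_idx a) p x.

Definition pair_compat (k : fieldType) (n : int) (P Q : modop k full)
  (V : smodule k (ofdim n)) (xi : shom (sshift V) (srestrict (ofdim n) P))
  (f : mohom P Q) (g : gmap V (srestrict (ofdim n) Q)) : Prop :=
  forall (a : idx (ofdim n)) (p : int) (x : V a (p + 1)),
    cdiff (Q (to_full a)) (erefl (p + 1)) (g a (p + 1) x) =
    f (to_full a) p (xi a p x).

(* [(iota, gamma)] is a universal pair: it exhibits [X] as P \sqcup_xi V. *)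
Definition is_principal_ext (k : fieldType) (n : int) (P X : modop k full)
  (V : smodule k (ofdim n)) (xi : shom (sshift V) (srestrict (ofdim n) P))
  (iota : mohom P X) (gamma : gmap V (srestrict (ofdim n) X)) : Prop :=
  pair_compat xi iota gamma /\
  forall (Q : modop k full) (f : mohom P Q)
    (g : gmap V (srestrict (ofdim n) Q)), pair_compat xi f g ->
  exists2 h : mohom X Q,
    (forall (a : idx full) (p : int) (x : P a p),
       h a p (iota a p x) = f a p x) /\
    (forall (a : idx (ofdim n)) (p : int) (x : V a p),
       h (to_full a) p (gamma a p x) = g a p x)
  & forall h' : mohom X Q,
    (forall (a : idx full) (p : int) (x : P a p),
       h' a p (iota a p x) = f a p x) ->
    (forall (a : idx (ofdim n)) (p : int) (x : V a p),
       h' (to_full a) p (gamma a p x) = g a p x) ->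
    forall (a : idx full) (p : int) (x : X a p), h' a p x = h a p x.

(* A modular Sigma-module concentrated in modular dimension n is given by its
   components of dimension n, i.e. as a [smodule k (ofdim n)]. *)
Definition principal_map (k : fieldType) (n : int) (A B : modop k full)
  (j : mohom A B) : Prop :=
  exists (V : smodule k (ofdim n)) (xi : shom (sshift V) (srestrict (ofdim n) A))
    (gamma : gmap V (srestrict (ofdim n) B)),
    zero_diff V /\ is_principal_ext xi j gamma.

Definition minimal (k : fieldType) (M : modop k full) : Prop :=
  forall n : nat,
  exists (A B : modop k full)
    (etaA : mohom (trunc (n%:Z - 1) M) (trunc (n%:Z - 1) A))
    (etaB : mohom (trunc n%:Z M) (trunc n%:Z B)) (j : mohom A B),
  [/\ is_tshriek etaA, is_tshriek etaB, is_tower_map etaA etaB j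
    & principal_map n%:Z j].

Definition cycle (k : fieldType) (C : complex k) (p : int) (x : C p) : Prop :=
  forall (q : int) (e : p = q + 1), cdiff C e x = 0.

(* Equality of the classes of two cycles in H_p(C). *)
Definition homologous (k : fieldType) (C : complex k) (p : int) (x y : C p) :
  Prop := exists z : C (p + 1), x - y = cdiff C (erefl (p + 1)) z.

(* The map induced by [f] on H_p((g, l)) is injective and surjective, for all
   p and (g, l). *)
Definition weak_equiv (k : fieldType) (P Q : modop k full) (f : mohom P Q) :
  Prop :=
  forall (a : idx full) (p : int),
    (forall x y : P a p, cycle x -> cycle y ->
       homologous (f a p x) (f a p y) -> homologous x y) /\
    (forall y : Q a p, cycle y ->
       exists2 x : P a p, cycle x & homologous (f a p x) y).

(* Main.v *)
From HB Require Import structures.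
From mathcomp Require Import all_boot all_order all_fingroup all_algebra.
From mathcomp Require Import zify.
From mathcomp Require Import boolp classical_sets.
Require Import Defs.

Set Implicit Arguments.
Unset Strict Implicit.
Unset Printing Implicit Defensive.

Import Order.TTheory GRing.Theory Num.Theory.
Local Open Scope ring_scope.

(** The minimal model is built by induction on the modular dimension, as the
    colimit of a tower of principal extensions over [P].

    Start from the zero operad.  Given a stage [f : A -> P], take in dimension
    [n] the homology of the mapping cone of [f], realized as an equivariant
    complement of the boundaries inside the cycles; this is where
    characteristic zero enters ([equivariant_retraction]).  Attaching it to [A]
    gives a principal extension [X] with a map to [P] that is a homology
    isomorphism in dimension [n] ([attach_cells]).

    That computation needs to know [X] up to dimension [n]: it is [A] below
    [n], and generated by [A] and the new generators in dimension [n], where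
    [A] still embeds.  Principal extensions are constructed as quotients of
    formal expressions by equality of all possible values, so the universal
    property and the spanning statements are read off the expressions
    ([ext_universal], [ext_base_surj], [ext_gen_surj]).  Injectivity needs a
    target in which the generators have room: an operad that is the cone of the
    identity of [A] in dimension [n] ([principal_map_inj]).  It is available
    because every operation strictly raises the dimension, so that operations
    with values in high dimensions may be set to 0 ([transfer]).

    For the tower, each stage is freely generated by its components of
    dimension [< n] ([principal_gen_below]), and the colimit agrees with the
    [n]-th stage in those dimensions.  Hence the stages are the values at the
    truncations of the colimit of the left adjoint to truncation, and the maps
    between them are the canonical tower ([colim_minimal]).  A component of
    dimension [n] of the colimit is that of stage [n + 1], so the map to [P] is
    a weak equivalence. *)

(** * Modular dimension *)

Definition dim (D : pred mindex) (a : idx D) : nat :=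
  (3 * genus a + legs a - 3)%N.

Lemma stable_genus_legs (D : pred mindex) (a : idx D) :
  (2 < 2 * genus a + legs a)%N.
Proof. exact: (valP (val a)). Qed.

Lemma moddimE (D : pred mindex) (a : idx D) : moddim (val a) = (dim a)%:Z.
Proof.
rewrite /moddim /dim; have := stable_genus_legs a; rewrite /genus /legs; lia.
Qed.

Lemma upto_dim (D : pred mindex) (m : int) (n : nat) (a : idx D) :
  m = n%:Z - 1 -> upto m (val a) = (dim a < n)%N.
Proof. by move=> ->; rewrite /upto moddimE; lia. Qed.

Lemma ofdim_dim (D : pred mindex) (n : nat) (a : idx D) :
  ofdim n%:Z (val a) = (dim a == n).
Proof. by rewrite /ofdim moddimE eqz_nat. Qed.

(** Compositions and contractions strictly raise the dimension.  An operation
    with values in dimension [n] thus only sees components of dimension [< n],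
    which is what makes an induction on the dimension possible. *)
Lemma dim_gluable (D : pred mindex) (a b c : idx D) :
  gluable a b c -> dim c = (dim a + dim b).+1.
Proof.
case/and3P=> /eqP eg l0 /eqP el; rewrite /dim eg.
have := stable_genus_legs a; have := stable_genus_legs b; lia.
Qed.

Lemma dim_contractible (D : pred mindex) (a c : idx D) :
  contractible a c -> dim c = (dim a).+1.
Proof.
case/andP=> /eqP eg /eqP el; rewrite /dim eg.
have := stable_genus_legs a; lia.
Qed.

Lemma gluable_ltl (D : pred mindex) (a b c : idx D) (n : nat) :
  gluable a b c -> (dim c < n)%N -> (dim a < n)%N.
Proof. by move/dim_gluable=> ->; lia. Qed.

Lemma gluable_ltr (D : pred mindex) (a b c : idx D) (n : nat) :
  gluable a b c -> (dim c < n)%N -> (dim b < n)%N.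
Proof. by move/dim_gluable=> ->; lia. Qed.

Lemma contractible_lt (D : pred mindex) (a c : idx D) (n : nat) :
  contractible a c -> (dim c < n)%N -> (dim a < n)%N.
Proof. by move/dim_contractible=> ->; lia. Qed.

Lemma to_fullP (D : pred mindex) (a : idx full) :
  D (val a) -> exists b : idx D, a = to_full b.
Proof. by move=> Da; exists (exist _ (val a) Da); apply: val_inj. Qed.

(** * Elementary morphisms *)

Section Morphisms.
Variable k : fieldType.

Lemma mcomp0l (D : pred mindex) (P : modop k D) (a b c : idx D)
  (e : gluable a b c) (i : 'I_(legs a)) (p q r : int) (d : p + q = r)
  (y : P b q) : mcomp P e i d 0 y = 0.
Proof.
have := mcomp_linearl e i d y 1 0 0; rewrite !scale1r addr0.
by move/(congr1 (fun z => z - mcomp P e i d 0 y)); rewrite subrr addrK.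
Qed.

Lemma mcompDl (D : pred mindex) (P : modop k D) (a b c : idx D)
  (e : gluable a b c) (i : 'I_(legs a)) (p q r : int) (d : p + q = r)
  (x x' : P a p) (y : P b q) :
  mcomp P e i d (x + x') y = mcomp P e i d x y + mcomp P e i d x' y.
Proof. by have := mcomp_linearl e i d y 1 x x'; rewrite !scale1r. Qed.

Lemma mcompZl (D : pred mindex) (P : modop k D) (a b c : idx D)
  (e : gluable a b c) (i : 'I_(legs a)) (p q r : int) (d : p + q = r) t
  (x : P a p) (y : P b q) :
  mcomp P e i d (t *: x) y = t *: mcomp P e i d x y.
Proof. by have := mcomp_linearl e i d y t x 0; rewrite mcomp0l !addr0. Qed.

(** Morphisms are nested records.  Filling all levels at once from one family
    of functions keeps that family visible to conversion. *)
Definition build_gmap (D : pred mindex) (E F : smodule k D)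
  (f : forall (a : idx D) (p : int), E a p -> F a p)
  (lin : forall a p, linear (f a p))
  (act : forall a p (s : {perm 'I_(legs a)}) (x : E a p),
    f a p (sact E s x) = sact F s (f a p x)) : gmap E F :=
  @GMap k D E F f lin act.

Definition build_shom (D : pred mindex) (E F : smodule k D)
  (f : forall (a : idx D) (p : int), E a p -> F a p)
  (lin : forall a p, linear (f a p))
  (act : forall a p (s : {perm 'I_(legs a)}) (x : E a p),
    f a p (sact E s x) = sact F s (f a p x))
  (chain : forall a p q (e : p = q + 1) (x : E a p),
    cdiff (F a) e (f a p x) = f a q (cdiff (E a) e x)) : shom E F :=
  @SHom k D E F (@GMap k D E F f lin act) chain.

Definition build_mohom (D : pred mindex) (P Q : modop k D)
  (f : forall (a : idx D) (p : int), P a p -> Q a p)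
  (lin : forall a p, linear (f a p))
  (act : forall a p (s : {perm 'I_(legs a)}) (x : P a p),
    f a p (sact P s x) = sact Q s (f a p x))
  (chain : forall a p q (e : p = q + 1) (x : P a p),
    cdiff (Q a) e (f a p x) = f a q (cdiff (P a) e x))
  (comp : forall a b c (e : gluable a b c) (i : 'I_(legs a)) p q r
    (d : p + q = r) (x : P a p) (y : P b q),
    f c r (mcomp P e i d x y) = mcomp Q e i d (f a p x) (f b q y))
  (contr : forall a c (e : contractible a c) (i j : 'I_(legs a))
    (ij : i != j) p (x : P a p),
    f c p (mcontr P e ij x) = mcontr Q e ij (f a p x)) : mohom P Q :=
  @MOHom k D P Q (@SHom k D P Q (@GMap k D P Q f lin act) chain) comp contr.

(** Operads have no units here, so the zero family is a morphism. *)
Definition mohom0 (D : pred mindex) (P Q : modop k D) : mohom P Q.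
Proof.
apply: (@build_mohom D P Q (fun _ _ _ => 0)) => *.
- by move=> t x y; rewrite scaler0 addr0.
- by rewrite linear0.
- by rewrite linear0.
- by rewrite mcomp0l.
- by rewrite linear0.
Defined.

Definition mohom_id (D : pred mindex) (P : modop k D) : mohom P P.
Proof. by apply: (@build_mohom D P P (fun _ _ x => x)). Defined.

Definition mohom_compose (D : pred mindex) (P Q R : modop k D)
  (g : mohom Q R) (f : mohom P Q) : mohom P R.
Proof.
apply: (@build_mohom D P R (fun a p x => g a p (f a p x))) => *.
- by move=> t x y; rewrite !linearP.
- by rewrite !gmap_act.
- by rewrite !shom_diff.
- by rewrite !mohom_comp.
- by rewrite !mohom_contr.
Defined.

End Morphisms.

(** * Equivariant complements *)

Section Retraction.
Variables (k : fieldType) (E : lmodType k) (B : E -> Prop).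
Hypotheses (B0 : B 0) (Blin : forall t x y, B x -> B y -> B (t *: x + y)).

(** [C 0] is not asked for: the union of the empty chain must qualify. *)
Let transversal (C : set E) : Prop :=
  (forall t x y, C x -> C y -> C (t *: x + y)) /\
  (forall x, C x -> B x -> x = 0).

(** By Zorn's lemma: a maximal subspace meeting [B] only in 0 is a
    complement. *)
Lemma complement_exists : exists C : E -> Prop,
  [/\ C 0, forall t x y, C x -> C y -> C (t *: x + y),
      forall x, C x -> B x -> x = 0 &
      forall x, exists b c, [/\ B b, C c & x = b + c]].
Proof.
have [F FP tot|A [[Alin AB] Amax]] := @Zorn_bigcup E transversal.
  split=> [t x y [X FX Xx] [Y FY Yy]|x [X FX Xx]]; last first.
    by have [_] := FP _ FX; apply.
  have [XY|YX] := tot _ _ FX FY.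
    by exists Y => //; have [+ _] := FP _ FY; apply=> //; apply: XY.
  by exists X => //; have [+ _] := FP _ FX; apply=> //; apply: YX.
pose C x := x = 0 \/ A x.
have A0 x : A x -> A 0.
  by move=> Ax; rewrite -(addNr x) -scaleN1r; apply: Alin.
have Clin t x y : C x -> C y -> C (t *: x + y).
  move=> [->|Ax] Cy; first by rewrite scaler0 add0r.
  right; apply: Alin => //; case: Cy => [->|//]; exact: A0 Ax.
have CB x : C x -> B x -> x = 0 by move=> [//|Ax]; apply: AB.
exists C; split=> //; first by left.
move=> x; apply: contrapT => nx.
have xC t b c : B b -> C c -> t *: x = b + c -> t = 0.
  move=> Bb Cc e; apply: contrapT => /eqP t0; apply: nx.
  exists (t^-1 *: b), (t^-1 *: c); split.
  - by rewrite -[_ *: b]addr0; apply: Blin.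
  - by rewrite -[_ *: c]addr0; apply: Clin => //; left.
  - by rewrite -scalerDr -e scalerA mulVf // scale1r.
(* If [x] is not a sum, [C] and [x] span a larger transversal subspace. *)
pose D : set E := fun u => exists t c, C c /\ u = t *: x + c.
apply: (Amax D); last first.
  split=> [t u v [s [c [Cc ->]]] [s' [c' [Cc' ->]]]|u [t [c [Cc ->]]] Bu].
    exists (t * s + s'), (t *: c + c'); split; first exact: Clin.
    by rewrite scalerDr scalerDl scalerA addrACA.
  have t0 : t = 0.
    apply: (xC t (t *: x + c) (- c)) => //; last by rewrite addrK.
    by rewrite -scaleN1r -[X in C X]addr0; apply: Clin => //; left.
  by move: Bu; rewrite t0 scale0r add0r; apply: CB.
split=> [u Au|/(_ x) /= DA].
  by exists 0, u; split; [right | rewrite scale0r add0r].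
apply: nx; exists 0, x; split=> //; last by rewrite add0r.
by right; apply: DA; exists 1, 0; split; [left | rewrite scale1r addr0].
Qed.

Lemma retraction_exists : exists r : E -> E,
  [/\ linear r, forall x, B (r x) & forall x, B x -> r x = x].
Proof.
have [C [C0 Clin CB dec]] := complement_exists.
pose spec x b := B b /\ C (x - b).
have spec_ex x : exists b, spec x b.
  by have [b [c [Bb Cc ->]]] := dec x; exists b; split; rewrite // addrC addKr.
have spec_uniq x b b' : spec x b -> spec x b' -> b = b'.
  move=> [Bb Cb] [Bb' Cb']; apply/eqP; rewrite -subr_eq0; apply/eqP/CB.
    have -> : b - b' = -1 *: (x - b) + (x - b').
      by rewrite scaleN1r opprB addrA subrK.
    exact: Clin.
  by rewrite addrC -scaleN1r; apply: Blin.
pose r x := sval (cid (spec_ex x)).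
have rP x : spec x (r x) by rewrite /r; case: cid.
exists r; split=> [t x y|x|x Bx]; last 2 first.
- by case: (rP x).
- by apply: (spec_uniq x) (rP x) _; split; rewrite // subrr.
apply: spec_uniq (rP _) _; have [Bx Cx] := rP x; have [By Cy] := rP y.
split; first exact: Blin.
by rewrite opprD addrACA -scalerBr; apply: Clin.
Qed.

(** Maschke's argument: averaging a linear retraction over the group makes it
    equivariant. *)
Lemma equivariant_retraction (gT : finGroupType) (act : gT -> E -> E) :
  #|gT|%:R != 0 :> k ->
  (forall s, linear (act s)) ->
  (forall x, act 1%g x = x) ->
  (forall s t x, act (s * t)%g x = act t (act s x)) ->
  (forall s x, B x -> B (act s x)) ->
  exists r : E -> E,
  [/\ linear r, forall x, B (r x), forall x, B x -> r x = x &
      forall s x, r (act s x) = act s (r x)].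
Proof.
move=> g0 actl act1 actM actB; have [r [rl rB rid]] := retraction_exists.
have B_sum (I : finType) (F : I -> E) :
    (forall i, B (F i)) -> B (\sum_i F i).
  move=> BF; elim/big_ind: _ => // x y Bx By.
  by rewrite -[x]scale1r; apply: Blin.
have act_lin s t x y : act s (t *: x + y) = t *: act s x + act s y.
  exact: actl.
have act0 s : act s 0 = 0.
  have := act_lin s (-1) 0 0.
  by rewrite scaler0 addr0 scaleN1r addNr.
have actD s x y : act s (x + y) = act s x + act s y.
  by rewrite -[x]scale1r act_lin !scale1r.
have actZ s t x : act s (t *: x) = t *: act s x.
  by rewrite -[t *: x]addr0 act_lin act0 addr0.
exists (fun x => #|gT|%:R^-1 *: \sum_(s : gT) act s^-1%g (r (act s x))).
split=> [t x y|x|x Bx|t x].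
- rewrite scalerA mulrC -scalerA -scalerDr; congr (_ *: _).
  rewrite scaler_sumr -big_split /=; apply: eq_bigr => s _.
  by rewrite act_lin rl act_lin.
- rewrite -[X in B X]addr0; apply: Blin => //; apply: B_sum => s.
  exact: actB.
- rewrite (eq_bigr (fun=> x)); last first.
    by move=> s _; rewrite rid; [rewrite -actM mulgV act1 | apply: actB].
  rewrite sumr_const -[#|_|]/#|gT| -scaler_nat scalerA mulVf ?scale1r //.
- rewrite actZ (big_morph _ (actD t) (act0 t)); congr (_ *: _).
  rewrite [RHS](reindex_inj (mulgI t)) /=; apply: eq_bigr => s _.
  by rewrite -!actM invMg mulgKV.
Qed.

End Retraction.

(** * Transporting a low-dimensional structure along a retract *)

(** Let [u : P -> E] and [v : E -> P] be maps with [v u = id] in low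
    dimensions.  Conjugating the operations of [P] by [u] and [v], and setting
    to 0 those with values in dimension [>= n], makes [E] an operad: an
    iterated operation with values in dimension [< n] only meets intermediate
    components of dimension [< n], where [v u] can be cancelled.  For the same
    reason [u] and [v] need to commute with the differentials only in low
    dimensions, so that [E] may carry a different differential in the top
    dimension.  This gives explicit targets for testing universal
    properties. *)

Section Transfer.
Variables (k : fieldType) (n : nat) (P : modop k full) (E : smodule k full).
Variables (u : gmap P E) (v : gmap E P).
Hypothesis vuK : forall (a : idx full) (p : int) (x : P a p),
  (dim a < n)%N -> v a p (u a p x) = x.
Hypothesis u_diff : forall (a : idx full) (p q : int) (e : p = q + 1)
  (x : P a p), (dim a < n)%N ->
  cdiff (E a) e (u a p x) = u a q (cdiff (P a) e x).
Hypothesis v_diff : forall (a : idx full) (p q : int) (e : p = q + 1)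
  (x : E a p), ((dim a).+1 < n)%N ->
  cdiff (P a) e (v a p x) = v a q (cdiff (E a) e x).

Definition transfer_comp (a b c : idx full) (e : gluable a b c)
  (i : 'I_(legs a)) (p q r : int) (d : p + q = r) (x : E a p) (y : E b q) :
  E c r :=
  if (dim c < n)%N then u c r (mcomp P e i d (v a p x) (v b q y)) else 0.

Definition transfer_contr (a c : idx full) (e : contractible a c)
  (i j : 'I_(legs a)) (ij : i != j) (p : int) (x : E a p) : E c p :=
  if (dim c < n)%N then u c p (mcontr P e ij (v a p x)) else 0.

Lemma transfer_comp_lt (a b c : idx full) (e : gluable a b c)
  (i : 'I_(legs a)) (p q r : int) (d : p + q = r) (x : E a p) (y : E b q) :
  (dim c < n)%N ->
  transfer_comp e i d x y = u c r (mcomp P e i d (v a p x) (v b q y)).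
Proof. by rewrite /transfer_comp => ->. Qed.

Lemma transfer_contr_lt (a c : idx full) (e : contractible a c)
  (i j : 'I_(legs a)) (ij : i != j) (p : int) (x : E a p) :
  (dim c < n)%N ->
  transfer_contr e ij x = u c p (mcontr P e ij (v a p x)).
Proof. by rewrite /transfer_contr => ->. Qed.

Lemma transfer_comp_ge (a b c : idx full) (e : gluable a b c)
  (i : 'I_(legs a)) (p q r : int) (d : p + q = r) (x : E a p) (y : E b q) :
  (n <= dim c)%N -> transfer_comp e i d x y = 0.
Proof. by rewrite /transfer_comp ltnNge => ->. Qed.

Lemma transfer_contr_ge (a c : idx full) (e : contractible a c)
  (i j : 'I_(legs a)) (ij : i != j) (p : int) (x : E a p) :
  (n <= dim c)%N -> transfer_contr e ij x = 0.
Proof. by rewrite /transfer_contr ltnNge => ->. Qed.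

Let compE := (transfer_comp_lt, transfer_contr_lt).
Let compE0 := (transfer_comp_ge, transfer_contr_ge).

Definition transfer : modop k full.
Proof.
refine (@ModOp k full E transfer_comp transfer_contr
  _ _ _ _ _ _ _ _ _ _ _ _ _ _ _).
- move=> a b c e i p q r d y t x x'; have [h|h] := ltnP (dim c) n.
    by rewrite !compE // linearP mcompDl mcompZl linearP.
  by rewrite !compE0 // scaler0 addr0.
- move=> a b c e i p q r d x t y y'; have [h|h] := ltnP (dim c) n.
    by rewrite !compE // !linearP.
  by rewrite !compE0 // scaler0 addr0.
- move=> a b c e i p q r p' q' r' d ex ey ez dl dr x y.
  have [h|h] := ltnP (dim c) n; last first.
    by rewrite !compE0 // scaler0 addr0 linear0.
  have ha : ((dim a).+1 < n)%N by move: h; rewrite (dim_gluable e); lia.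
  have hb : ((dim b).+1 < n)%N by move: h; rewrite (dim_gluable e); lia.
  rewrite !compE // u_diff // (mcomp_diff e i d ex ey ez dl dr).
  by rewrite linearD linearZ /= !v_diff.
- move=> a c e i j ij p t x y; have [h|h] := ltnP (dim c) n.
    by rewrite !compE // !linearP.
  by rewrite !compE0 // scaler0 addr0.
- move=> a c e i j ij p q ep x; have [h|h] := ltnP (dim c) n; last first.
    by rewrite !compE0 // linear0.
  have ha : ((dim a).+1 < n)%N by move: h; rewrite (dim_contractible e).
  by rewrite !compE // u_diff // mcontr_diff v_diff.
- move=> a b c e i p q r d x y s t w H1 H2 H3.
  have [h|h] := ltnP (dim c) n; last by rewrite !compE0 // linear0.
  by rewrite !compE // !gmap_act (mcomp_act e d _ _ H1 H2 H3) gmap_act.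
- move=> a c e i j p x s w ij sij H.
  have [h|h] := ltnP (dim c) n; last by rewrite !compE0 // linear0.
  by rewrite !compE // !gmap_act (mcontr_act e _ ij sij H) gmap_act.
- move=> a b c e e' i j p q r d d' x y s w H1 H2 H3 H4.
  have [h|h] := ltnP (dim c) n; last by rewrite !compE0 // linear0 scaler0.
  rewrite !compE // !gmap_act -gmap_act.
  by rewrite (mcomp_comm e e' d d' _ _ H1 H2 H3 H4) linearZ.
- move=> a c e i j ij ji p x.
  have [h|h] := ltnP (dim c) n; last by rewrite !compE0.
  by rewrite !compE // (mcontr_sym e ij ji).
- move=> a b c ab bc abc e1 e2 e3 e4 i o o' p q r pq qr pqr d1 d2 d3 d4 x y z.
  move=> H1 H2; have [h|h] := ltnP (dim abc) n; last by rewrite !compE0.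
  have h2 := gluable_ltl e2 h; have h4 := gluable_ltr e4 h.
  by rewrite !compE // !vuK // (mcomp_seq e1 e2 e3 e4 d1 d2 d3 d4 _ _ _ H1 H2).
- move=> a b c ab ac abc e1 e2 e3 e4 i j j' i' p q r pq pr pqr d1 d2 d3 d4.
  move=> x y z H1 H2 H3; have [h|h] := ltnP (dim abc) n; last first.
    by rewrite !compE0 // scaler0.
  have h2 := gluable_ltl e2 h; have h4 := gluable_ltl e4 h.
  rewrite !compE // !vuK //.
  by rewrite (mcomp_par e1 e2 e3 e4 d1 d2 d3 d4 _ _ _ H1 H2 H3) linearZ.
- move=> a b b' c e1 e2 e3 e4 i j m o m' o' i' j' ij mo mo' ij' p x.
  move=> H1 H2 H3 H4 H5 H6 H7 H8.
  have [h|h] := ltnP (dim c) n; last by rewrite !compE0.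
  have h2 := contractible_lt e2 h; have h4 := contractible_lt e4 h.
  by rewrite !compE // !vuK // (mcontr_contr e1 e2 e3 e4 ij mo mo' ij' _ H1).
- move=> a b c a' c' e1 e2 e3 e4 i m o m' o' i' mo mo' p q r d x y.
  move=> H1 H2 H3 H4 H5.
  have [h|h] := ltnP (dim c') n; last by rewrite !compE0.
  have h2 := contractible_lt e2 h; have h4 := gluable_ltl e4 h.
  rewrite !compE // !vuK //.
  by rewrite (mcontr_compl e1 e2 e3 e4 mo mo' d _ _ H1 H2 H3 H4 H5).
- move=> a b c b' c' e1 e2 e3 e4 i m o m' o' mo mo' p q r d x y.
  move=> H1 H2 H3 H4.
  have [h|h] := ltnP (dim c') n; last by rewrite !compE0.
  have h2 := contractible_lt e2 h; have h4 := gluable_ltr e4 h.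
  rewrite !compE // !vuK //.
  by rewrite (mcontr_compr e1 e2 e3 e4 mo mo' d _ _ H1 H2 H3 H4).
- move=> a b c c' e1 e2 i m o l t m' l' i' o' ml' io' w p q r d x y.
  move=> H1 H2 H3 H4 H5 H6 H7 H8 H9 H10.
  have [h|h] := ltnP (dim c') n; last by rewrite !compE0 // linear0.
  have h2 := contractible_lt e2 h.
  rewrite !compE // !vuK // -!gmap_act.
  rewrite (mcontr_compm e1 e2 ml' io' d _ _ H1 H2 H3 H4 H5 H6 H7 H8 H9 H10).
  by rewrite -gmap_act.
Defined.

End Transfer.

(** * Cutting off high dimensions *)

Section Cut.
Variable k : fieldType.

Definition gmap_id (D : pred mindex) (E : smodule k D) : gmap E E :=
  @GMap k D E E (fun a p x => x)
    (fun a p => fun t x y => erefl) (fun a p s x => erefl).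

(** A morphism into [Q] defined in dimensions [< n] only becomes, extended by 0,
    a morphism into [cut n Q] ([cut_lift]).  Uniqueness properties of
    morphisms out of an operad can therefore be applied to partial
    morphisms. *)
Definition cut (n : nat) (Q : modop k full) : modop k full :=
  @transfer k n Q Q (gmap_id Q) (gmap_id Q) (fun a p x _ => erefl)
    (fun a p q e x _ => erefl) (fun a p q e x _ => erefl).

(** A morphism between truncations, encoded by functions on all components
    whose values in dimensions [>= n] are arbitrary. *)
Record hom_below (n : nat) (A Q : modop k full)
  (F : forall (a : idx full) (p : int), A a p -> Q a p) : Prop := HomBelow {
  below_linear : forall (a : idx full) (p : int), (dim a < n)%N ->
    linear (F a p);
  below_act : forall (a : idx full) (p : int) (s : {perm 'I_(legs a)})
    (x : A a p), (dim a < n)%N -> F a p (sact A s x) = sact Q s (F a p x);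
  below_diff : forall (a : idx full) (p q : int) (e : p = q + 1) (x : A a p),
    (dim a < n)%N -> cdiff (Q a) e (F a p x) = F a q (cdiff (A a) e x);
  below_comp : forall (a b c : idx full) (e : gluable a b c)
    (i : 'I_(legs a)) (p q r : int) (d : p + q = r) (x : A a p) (y : A b q),
    (dim c < n)%N ->
    F c r (mcomp A e i d x y) = mcomp Q e i d (F a p x) (F b q y);
  below_contr : forall (a c : idx full) (e : contractible a c)
    (i j : 'I_(legs a)) (ij : i != j) (p : int) (x : A a p),
    (dim c < n)%N -> F c p (mcontr A e ij x) = mcontr Q e ij (F a p x)
}.

Definition cut_lift (n : nat) (A Q : modop k full)
  (F : forall (a : idx full) (p : int), A a p -> Q a p)
  (H : hom_below n F) : mohom A (cut n Q).
Proof.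
apply: (@build_mohom k full A (cut n Q)
  (fun a p x => if (dim a < n)%N then F a p x else 0)).
- move=> a p t x y; case: ifP => h; last by rewrite scaler0 addr0.
  exact: (below_linear H h).
- move=> a p s x; case: ifP => h; last by rewrite linear0.
  exact: (below_act H).
- move=> a p q e x; case: ifP => h; last by rewrite linear0.
  exact: (below_diff H).
- move=> a b c e i p q r d x y; rewrite /= /transfer_comp /=.
  case: ifP => // h.
  by rewrite (gluable_ltl e h) (gluable_ltr e h) (below_comp H).
- move=> a c e i j ij p x; rewrite /= /transfer_contr /=.
  case: ifP => // h.
  by rewrite (contractible_lt e h) (below_contr H).
Defined.

Lemma cut_liftE (n : nat) (A Q : modop k full)
  (F : forall (a : idx full) (p : int), A a p -> Q a p) (H : hom_below n F)
  (a : idx full) (p : int) (x : A a p) :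
  cut_lift H a p x = if (dim a < n)%N then F a p x else 0.
Proof. reflexivity. Qed.

Lemma mohom_below (n : nat) (A Q : modop k full) (h : mohom A Q) :
  hom_below n (h : forall a p, A a p -> Q a p).
Proof.
split=> *; first exact: gmap_linear.
- exact: gmap_act.
- exact: shom_diff.
- exact: mohom_comp.
- exact: mohom_contr.
Qed.

Lemma below_compose (n : nat) (A B Q : modop k full)
  (F : forall (a : idx full) (p : int), A a p -> B a p)
  (G : forall (a : idx full) (p : int), B a p -> Q a p) :
  hom_below n F -> hom_below n G ->
  hom_below n (fun a p x => G a p (F a p x)).
Proof.
move=> HF HG; split.
- by move=> a p h t x y; rewrite (below_linear HF h) (below_linear HG h).
- by move=> a p s x h; rewrite (below_act HF) // (below_act HG).
- by move=> a p q e x h; rewrite (below_diff HG) // (below_diff HF).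
- move=> a b c e i p q r d x y h.
  by rewrite (below_comp HF) // (below_comp HG).
- move=> a c e i j ij p x h.
  by rewrite (below_contr HF) // (below_contr HG).
Qed.

(** [A] is freely generated by its components of dimension [< n], i.e.
    [A] is the value at its own [(n - 1)]-truncation of the left adjoint. *)
Definition gen_below (n : nat) (A : modop k full) : Prop :=
  forall (Q : modop k full)
    (F : forall (a : idx full) (p : int), A a p -> Q a p),
  hom_below n F ->
  exists2 h : mohom A Q,
    forall a p (x : A a p), (dim a < n)%N -> h a p x = F a p x
  & forall h' : mohom A Q,
    (forall a p (x : A a p), (dim a < n)%N -> h' a p x = F a p x) ->
    forall a p (x : A a p), h' a p x = h a p x.

Lemma gen_below_eq (n : nat) (A Q : modop k full) (h h' : mohom A Q) :
  gen_below n A ->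
  (forall a p (x : A a p), (dim a < n)%N -> h a p x = h' a p x) ->
  forall a p (x : A a p), h a p x = h' a p x.
Proof.
move=> gA hh' a p x; have [f _ fP] := gA _ _ (mohom_below n h').
by rewrite (fP h) // (fP h').
Qed.

(** Attaching generators of dimension [n] preserves free generation.  Given [F]
    on [X] in dimensions [<= n], its restriction to [A] extends to [h'] because
    [A] is generated below [n]; the values of [F] on the new generators then
    give [h] by the universal property of [X].  The equalities needed in
    dimension [n] itself, between [h'] and [F] on [A] and between [h] and [F] on
    [X], are equalities of morphisms into [cut n.+1 Q]; there the uniqueness
    clauses for [A] and for [X] apply. *)
Lemma principal_gen_below (n : nat) (A X : modop k full) (j : mohom A X) :
  gen_below n A -> principal_map n%:Z j -> gen_below n.+1 X.
Proof.
move=> gA [V [xi [gamma [_ [compat univ]]]]] Q F HF.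
have HFj := below_compose (mohom_below n.+1 j) HF.
have HFj' : hom_below n (fun a p (x : A a p) => F a p (j a p x)).
  by case: HFj => *; split=> *; auto.
have [h' h'F h'uniq] := gA _ _ HFj'.
have h'F1 a p (x : A a p) : (dim a < n.+1)%N -> h' a p x = F a p (j a p x).
  move=> h.
  have := @gen_below_eq _ _ _
    (cut_lift (mohom_below n.+1 h')) (cut_lift HFj) gA.
  move/(_ _ a p x); rewrite !cut_liftE h; apply=> b q y hb.
  by rewrite !cut_liftE; case: ifP => // _; exact: h'F.
have dimV (a : idx (ofdim n%:Z)) : (dim (to_full a) < n.+1)%N.
  by have := valP a; rewrite /= (ofdim_dim n (to_full a)) => /eqP->.
have @g : gmap V (srestrict (ofdim n%:Z) Q).
  apply: (@build_gmap k _ V (srestrict (ofdim n%:Z) Q)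
            (fun a p x => F (to_full a) p (gamma a p x))).
    move=> a p t x y; rewrite linearP /=.
    exact: (below_linear HF (dimV a)).
  by move=> a p s x; rewrite gmap_act /= (below_act HF).
have gcompat : pair_compat xi h' g.
  move=> a p x /=.
  by rewrite (below_diff HF) // h'F1 // -(compat a p x).
have [h [hj hg] huniq] := univ Q h' g gcompat.
have hF a p (x : X a p) : (dim a < n.+1)%N -> h a p x = F a p x.
  move=> ha.
  pose L := cut_lift HF; pose R := cut_lift (mohom_below n.+1 h).
  suff RL : forall a p (x : X a p), R a p x = L a p x.
    by have := RL a p x; rewrite !cut_liftE ha.
  have @gL : gmap V (srestrict (ofdim n%:Z) (cut n.+1 Q)).
    apply: (@build_gmap k _ V (srestrict (ofdim n%:Z) (cut n.+1 Q))
            (fun a p x => L (to_full a) p (gamma a p x))).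
      by move=> b q t y z; rewrite !linearP.
    by move=> b q s y; rewrite !gmap_act.
  have cL : pair_compat xi (mohom_compose L j) gL.
    move=> b q y.
    change (cdiff (cut n.+1 Q (to_full b)) (erefl (q + 1))
              (L (to_full b) (q + 1) (gamma b (q + 1) y)) =
            L (to_full b) q (j (to_full b) q (xi b q y))).
    by rewrite (shom_diff L) (compat b q y).
  have [f _ fP] := univ _ _ _ cL.
  move=> b q y; rewrite (fP L) // (fP R) //.
    move=> {}b {}q {}y.
    rewrite [RHS]/= !cut_liftE; case: ifP => // hb.
    by rewrite hj h'F1.
  move=> {}b {}q {}y; rewrite [RHS]/= !cut_liftE dimV.
  by rewrite hg.
exists h => // h2 h2F; apply: huniq.
  move=> a p x; apply: (h'uniq (mohom_compose h2 j)) => b q y hb.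
  by apply: (h2F _ _ (j b q y)); apply: leqW.
by move=> a p x; apply: h2F.
Qed.

End Cut.

(** * The zero operad *)

Section Zero.
Variable k : fieldType.

Definition zero_complex : complex k.
Proof.
refine (@Complex k (fun _ => 'rV[k]_0 : lmodType k)
  (fun _ _ _ => id) _ _) => //.
by move=> p q r e e' x; rewrite [x]thinmx0.
Defined.

Definition zero_smodule : smodule k full.
Proof.
by refine (@SModule k full (fun=> zero_complex) (fun _ _ _ => id) _ _ _ _).
Defined.

Definition zero_modop : modop k full.
Proof.
by refine (@ModOp k full zero_smodule (fun _ _ _ _ _ _ _ _ _ _ _ => 0)
  (fun _ _ _ _ _ _ _ _ => 0) _ _ _ _ _ _ _ _ _ _ _ _ _ _ _) => *;
  do ?move=> ? ? ?; rewrite [LHS]thinmx0 [RHS]thinmx0.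
Defined.

Lemma zero_modop_gen_below : gen_below 0 zero_modop.
Proof.
move=> Q F _; exists (mohom0 _ _) => // h _ a p x.
by rewrite (_ : x = 0) ?linear0 //; apply: thinmx0.
Qed.

End Zero.

(** * Principal extensions are injective up to their dimension *)

(** Cones involve the degree [p - 1], and [(q + 1) - 1] is [q] only up to a
    proof; elements are moved along such equalities by [degree_cast]. *)

Section Cast.
Variables (k : fieldType) (C : complex k).

Definition degree_cast (p q : int) (e : p = q) (x : C p) : C q :=
  eq_rect p (fun r => C r) x q e.

Lemma degree_cast_linear (p q : int) (e : p = q) : linear (degree_cast e).
Proof. by case: q / e. Qed.

HB.instance Definition _ (p q : int) (e : p = q) :=
  GRing.isLinear.Build k (C p) (C q) _ (degree_cast e) (degree_cast_linear e).

Lemma degree_cast_id (p : int) (e : p = p) (x : C p) : degree_cast e x = x.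
Proof. by rewrite (eq_irrelevance e erefl). Qed.

Lemma cdiff_irr (p q : int) (e e' : p = q + 1) (x : C p) :
  cdiff C e x = cdiff C e' x.
Proof. by rewrite (eq_irrelevance e e'). Qed.

Lemma cdiff_cast (p p' q q' : int) (e1 : p = p') (e2 : p' = q + 1)
  (e3 : p = q' + 1) (e4 : q' = q) (x : C p) :
  cdiff C e2 (degree_cast e1 x) = degree_cast e4 (cdiff C e3 x).
Proof. by case: q / e4 e2; case: p' / e1 => e2; apply: cdiff_irr. Qed.

Lemma degree_cast_cast (p q r : int) (e : p = q) (e' : q = r) (e'' : p = r)
  (x : C p) : degree_cast e' (degree_cast e x) = degree_cast e'' x.
Proof. by case: r / e' e''; case: q / e => e'; rewrite !degree_cast_id. Qed.

End Cast.

Lemma sact_cast (k : fieldType) (D : pred mindex) (E : smodule k D)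
  (a : idx D) (p q : int) (e : p = q) (s : {perm 'I_(legs a)}) (x : E a p) :
  degree_cast e (sact E s x) = sact E s (degree_cast e x).
Proof. by case: q / e. Qed.

Lemma shom_cast (k : fieldType) (D : pred mindex) (V E : smodule k D)
  (xi : shom (sshift V) E) (b : idx D) (p q : int) (e : p + 1 = q + 1)
  (e' : q = p) (v : V b (p + 1)) :
  degree_cast e' (xi b q (degree_cast e v)) = xi b p v.
Proof. by case: p / e' e v => e v; rewrite !degree_cast_id. Qed.

Lemma pred_eq (p q : int) : p = q + 1 -> p - 1 = q.
Proof. by move=> ->; rewrite addrK. Qed.

Lemma pred_eq1 (p q : int) : p = q + 1 -> p - 1 = q - 1 + 1.
Proof. by move=> ->; rewrite addrK subrK. Qed.

Lemma pair_linE (k : fieldType) (U V : lmodType k) t (u u' : U) (v v' : V) :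
  t *: (u, v) + (u', v') = (t *: u + u', t *: v + v').
Proof. by []. Qed.

(** In dimension [n], replace [P] by the cone of its identity; in other
    dimensions add a shifted copy of [P] that no operation sees.  The map [xi] of
    any principal extension becomes a boundary there, so the inclusion of [P],
    which is injective up to dimension [n], extends over every principal
    extension of dimension [n]. *)

Section Cone.
Variables (k : fieldType) (n : nat) (P : modop k full).

Definition cone_diff (a : idx full) (p q : int) (e : p = q + 1)
  (u : P a p * P a (p - 1)) : P a q * P a (q - 1) :=
  (cdiff (P a) e u.1 +
     (if dim a == n then degree_cast (pred_eq e) u.2 else 0),
   - cdiff (P a) (pred_eq1 e) u.2).

Definition cone_complex (a : idx full) : complex k.
Proof.
refine (@Complex k (fun p => (P a p * P a (p - 1))%type : lmodType k)
  (@cone_diff a) _ _).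
- move=> p q e t x y; rewrite /cone_diff pair_linE; congr (_, _).
    rewrite !linearP scalerDr addrACA; case: ifP => // _.
    by rewrite scaler0 !addr0.
  by rewrite !linearP.
- move=> p q r e e' x; rewrite /cone_diff /=; congr (_, _).
    rewrite linearD /= cdiffK add0r; case: ifP => _; last first.
      by rewrite addr0 linear0.
    by rewrite linearN (cdiff_cast _ _ (pred_eq1 e) (pred_eq e')) subrr.
  by rewrite linearN /= cdiffK oppr0 oppr0.
Defined.

Definition cone_smodule : smodule k full.
Proof.
refine (@SModule k full cone_complex
  (fun a p s (u : P a p * P a (p - 1)) => (sact P s u.1, sact P s u.2))
  _ _ _ _).
- by move=> a p s t x y; rewrite /= !linearP.
- by move=> a p [x y] /=; rewrite !sact1.
- by move=> a p s t [x y] /=; rewrite !sactM.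
- move=> a p q e s [x y]; rewrite /= /cone_diff /=.
  rewrite !sact_diff sact_cast linearD linearN /=; congr (_ + _, _).
  by case: ifP => _ //; rewrite linear0.
Defined.

Definition cone_in : gmap P cone_smodule.
Proof.
apply: (@build_gmap k full P cone_smodule (fun a p x => (x, 0))).
  by move=> a p t x y; rewrite pair_linE scaler0 addr0.
by move=> a p s x /=; rewrite linear0.
Defined.

Definition cone_out : gmap cone_smodule P.
Proof.
by apply: (@build_gmap k full cone_smodule P (fun a p x => x.1)).
Defined.

Definition cone_modop : modop k full.
Proof.
apply: (@transfer k n.+1 P cone_smodule cone_in cone_out) => //.
- move=> a p q e x _; rewrite /= /cone_diff /=.
  by rewrite !linear0 if_same addr0.
- by move=> a p q e x h; rewrite /= /cone_diff /= ltn_eqF // addr0.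
Defined.

Definition cone_hom : mohom P cone_modop.
Proof.
apply: (@build_mohom k full P cone_modop
  (fun a p x => if (dim a <= n)%N then cone_in a p x else 0)).
- move=> a p t x y; case: ifP => _; first by rewrite linearP.
  by rewrite scaler0 addr0.
- move=> a p s x; case: ifP => _; last by rewrite linear0.
  by rewrite gmap_act.
- move=> a p q e x; case: ifP => _; last by rewrite linear0.
  by rewrite /= /cone_diff /= !linear0 if_same addr0.
- move=> a b c e i p q r d x y; rewrite /= /transfer_comp ltnS.
  case: ifP => // h.
  have ha : (dim a <= n)%N := gluable_ltl (n := n.+1) e h.
  have hb : (dim b <= n)%N := gluable_ltr (n := n.+1) e h.
  by rewrite ha hb.
- move=> a c e i j ij p x; rewrite /= /transfer_contr ltnS.
  case: ifP => // h.
  by have ha : (dim a <= n)%N := contractible_lt (n := n.+1) e h; rewrite ha.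
Defined.

(** [cone_hom] is injective up to dimension [n], and it factors through [j]. *)
Lemma principal_map_inj (X : modop k full) (j : mohom P X) (a : idx full)
  (p : int) (x : P a p) :
  principal_map n%:Z j -> (dim a <= n)%N -> j a p x = 0 -> x = 0.
Proof.
move=> [V [xi [gamma [V0 [_ univ]]]]] ha jx.
pose xi' (b : idx (ofdim n%:Z)) q (v : V b q) : P (to_full b) (q - 1) :=
  xi b (q - 1) (degree_cast (esym (subrK 1 q)) v).
have @g : gmap V (srestrict (ofdim n%:Z) cone_modop).
  apply: (@build_gmap k _ V (srestrict (ofdim n%:Z) cone_modop)
    (fun b q v => (0, xi' b q v))).
    move=> b q t v w; rewrite pair_linE scaler0 addr0 /xi' linearP.
    by congr (_, _); exact: (@gmap_linear _ _ _ _ xi b (q - 1)).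
  move=> b q s v /=; rewrite linear0 /xi' sact_cast.
  by congr (_, _); apply: (gmap_act xi).
have compat : pair_compat xi cone_hom g.
  move=> b q v; have /= := valP b; rewrite (ofdim_dim n (to_full b)) => hb.
  rewrite [RHS]/= (eqP hb) leqnn /= /cone_diff /= hb linear0 add0r.
  congr (_, _).
    exact: (@shom_cast _ _ V (srestrict _ P) xi b q (q + 1 - 1)).
  rewrite /xi' (shom_diff xi (pred_eq1 erefl)) /= /shift_diff V0.
  by rewrite oppr0 linear0 oppr0.
have [h [hj _] _] := univ _ _ _ compat.
have := hj a p x; rewrite jx linear0 /= ha.
by case.
Qed.

End Cone.

(** * Existence of principal extensions *)

(** The principal extension is built from formal expressions in the elements of
    [P] and [V].  Two expressions are identified when they take the same value
    in every operad [Q] equipped with a compatible pair [(f, g)].  No list of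
    relations is needed: an axiom of operads holds in the quotient because it
    holds in each [Q], and evaluation in [Q] is the required factorization. *)

Section PrincipalExtension.
Variables (k : fieldType) (n : nat) (P : modop k full).
Variables (V : smodule k (ofdim n%:Z)).
Variable (xi : shom (sshift V) (srestrict (ofdim n%:Z) P)).

Inductive term : idx full -> int -> Type :=
| TBase (a : idx full) (p : int) of P a p : term a p
| TGen (a : idx (ofdim n%:Z)) (p : int) of V a p : term (to_full a) p
| TZero (a : idx full) (p : int) : term a p
| TAdd (a : idx full) (p : int) of term a p & term a p : term a p
| TScale (a : idx full) (p : int) of k & term a p : term a p
| TAct (a : idx full) (p : int) of {perm 'I_(legs a)} & term a p : term a p
| TDiff (a : idx full) (p q : int) of p = q + 1 & term a p : term a q
| TComp (a b c : idx full) of gluable a b c & 'I_(legs a) :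
    forall p q r : int, p + q = r -> term a p -> term b q -> term c r
| TContr (a c : idx full) of contractible a c :
    forall i j : 'I_(legs a), i != j ->
    forall p : int, term a p -> term c p.

Record target := Target {
  tgt : modop k full;
  tgt_base : mohom P tgt;
  tgt_gen : gmap V (srestrict (ofdim n%:Z) tgt);
  tgt_compat : pair_compat xi tgt_base tgt_gen
}.

Fixpoint eval (T : target) (a : idx full) (p : int) (t : term a p) :
  tgt T a p :=
  match t in term a p return tgt T a p with
  | TBase a p x => tgt_base T a p x
  | TGen a p v => tgt_gen T a p v
  | TZero a p => 0
  | TAdd a p t u => eval T t + eval T u
  | TScale a p z t => z *: eval T t
  | TAct a p s t => sact (tgt T) s (eval T t)
  | TDiff a p q e t => cdiff (tgt T a) e (eval T t)
  | TComp a b c e i p q r d t u => mcomp (tgt T) e i d (eval T t) (eval T u)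
  | TContr a c e i j ij p t => mcontr (tgt T) e ij (eval T t)
  end.

Definition same_values (a : idx full) (p : int) (t u : term a p) : Prop :=
  forall T : target, eval T t = eval T u.

(** A point of the quotient is an equivalence class, as a predicate. *)
Definition ext_carrier (a : idx full) (p : int) : Type :=
  {S : term a p -> Prop | exists t, S = same_values t}.

Section Carrier.
Variables (a : idx full) (p : int).
Local Notation X := (ext_carrier a p).

Definition ext_class (t : term a p) : X :=
  exist _ (same_values t) (ex_intro _ t erefl).

Definition ext_repr (x : X) : term a p := sval (cid (svalP x)).

Definition value (T : target) (x : X) : tgt T a p := eval T (ext_repr x).

Lemma value_class (T : target) (t : term a p) :
  value T (ext_class t) = eval T t.
Proof.
rewrite /value /ext_repr; case: cid => u /= /(congr1 (fun S => S u)) e.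
by have -> : same_values t u by rewrite e.
Qed.

Lemma ext_class_repr (x : X) : ext_class (ext_repr x) = x.
Proof.
case: x => S hS; rewrite /ext_repr; case: cid => t /= e.
by move: hS; rewrite e => hS; congr exist; apply: Prop_irrelevance.
Qed.

Lemma value_inj (x y : X) : (forall T, value T x = value T y) -> x = y.
Proof.
move=> xy; rewrite -[x]ext_class_repr -[y]ext_class_repr.
have e : same_values (ext_repr x) = same_values (ext_repr y).
  apply/funext => t; apply/propext; split=> h T.
    by rewrite -h; apply/esym/xy.
  by rewrite -h; apply/xy.
rewrite /ext_class; move: (ex_intro _ (ext_repr x) _); rewrite e => h.
by congr exist; apply: Prop_irrelevance.
Qed.

HB.instance Definition _ := gen_eqMixin X.
HB.instance Definition _ := gen_choiceMixin X.

Definition ext_zero : X := ext_class (TZero a p).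
Definition ext_add (x y : X) : X := ext_class (TAdd (ext_repr x) (ext_repr y)).
Definition ext_scale (z : k) (x : X) : X := ext_class (TScale z (ext_repr x)).
Definition ext_opp (x : X) : X := ext_scale (-1) x.

Lemma value_zero T : value T ext_zero = 0.
Proof. exact: value_class. Qed.
Lemma value_add T x y : value T (ext_add x y) = value T x + value T y.
Proof. exact: value_class. Qed.
Lemma value_scale T z x : value T (ext_scale z x) = z *: value T x.
Proof. exact: value_class. Qed.
Let valueE := (value_zero, value_add, value_scale).

Lemma ext_addA : associative ext_add.
Proof. by move=> x y z; apply: value_inj => T; rewrite !valueE addrA. Qed.
Lemma ext_addC : commutative ext_add.
Proof. by move=> x y; apply: value_inj => T; rewrite !valueE addrC. Qed.
Lemma ext_add0 : left_id ext_zero ext_add.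
Proof. by move=> x; apply: value_inj => T; rewrite !valueE add0r. Qed.
Lemma ext_addN : left_inverse ext_zero ext_opp ext_add.
Proof.
by move=> x; apply: value_inj => T; rewrite !valueE scaleN1r addNr.
Qed.

HB.instance Definition _ :=
  GRing.isZmodule.Build X ext_addA ext_addC ext_add0 ext_addN.

Lemma ext_scaleA z w x : ext_scale z (ext_scale w x) = ext_scale (z * w) x.
Proof. by apply: value_inj => T; rewrite !valueE scalerA. Qed.
Lemma ext_scale1 : left_id 1 ext_scale.
Proof. by move=> x; apply: value_inj => T; rewrite !valueE scale1r. Qed.
Lemma ext_scaleDr : right_distributive ext_scale +%R.
Proof.
by move=> z x y; apply: value_inj => T; rewrite !valueE scalerDr.
Qed.
Lemma ext_scaleDl x : {morph ext_scale^~ x : z w / z + w}.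
Proof. by move=> z w; apply: value_inj => T; rewrite !valueE scalerDl. Qed.

HB.instance Definition _ := GRing.Zmodule_isLmodule.Build k X
  ext_scaleA ext_scale1 ext_scaleDr ext_scaleDl.

Lemma value_linear T : linear (value T).
Proof. by move=> z x y; rewrite -value_scale -value_add. Qed.

HB.instance Definition _ T :=
  GRing.isLinear.Build k X (tgt T a p) _ (value T) (value_linear T).

End Carrier.

Definition ext_act (a : idx full) (p : int) (s : {perm 'I_(legs a)})
  (x : ext_carrier a p) : ext_carrier a p := ext_class (TAct s (ext_repr x)).
Definition ext_diff (a : idx full) (p q : int) (e : p = q + 1)
  (x : ext_carrier a p) : ext_carrier a q := ext_class (TDiff e (ext_repr x)).
Definition ext_comp (a b c : idx full) (e : gluable a b c) (i : 'I_(legs a))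
  (p q r : int) (d : p + q = r) (x : ext_carrier a p) (y : ext_carrier b q) :
  ext_carrier c r := ext_class (TComp e i d (ext_repr x) (ext_repr y)).
Definition ext_contr (a c : idx full) (e : contractible a c)
  (i j : 'I_(legs a)) (ij : i != j) (p : int) (x : ext_carrier a p) :
  ext_carrier c p := ext_class (TContr e ij (ext_repr x)).

Lemma value_act T a p s (x : ext_carrier a p) :
  value T (ext_act s x) = sact (tgt T) s (value T x).
Proof. exact: value_class. Qed.
Lemma value_diff T a p q (e : p = q + 1) (x : ext_carrier a p) :
  value T (ext_diff e x) = cdiff (tgt T a) e (value T x).
Proof. exact: value_class. Qed.
Lemma value_comp T a b c (e : gluable a b c) i p q r (d : p + q = r)
  (x : ext_carrier a p) (y : ext_carrier b q) :
  value T (ext_comp e i d x y) = mcomp (tgt T) e i d (value T x) (value T y).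
Proof. exact: value_class. Qed.
Lemma value_contr T a c (e : contractible a c) i j (ij : i != j) p
  (x : ext_carrier a p) :
  value T (ext_contr e ij x) = mcontr (tgt T) e ij (value T x).
Proof. exact: value_class. Qed.
Let valueE := (value_act, value_diff, value_comp, value_contr).

Definition ext_complex (a : idx full) : complex k.
Proof.
refine (@Complex k (fun p => ext_carrier a p : lmodType k) (@ext_diff a) _ _).
  move=> p q e t x y; apply: value_inj => T.
  by rewrite [RHS]linearP /= !valueE !linearP.
by move=> p q r e e' x; apply: value_inj => T; rewrite linear0 !valueE cdiffK.
Defined.

Definition ext_smodule : smodule k full.
Proof.
refine (@SModule k full ext_complex (@ext_act) _ _ _ _).
- move=> a p s t x y; apply: value_inj => T.
  by rewrite [RHS]linearP /= !valueE !linearP.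
- by move=> a p x; apply: value_inj => T; rewrite !valueE sact1.
- by move=> a p s t x; apply: value_inj => T; rewrite !valueE sactM.
- by move=> a p q e s x; apply: value_inj => T; rewrite !valueE sact_diff.
Defined.

Definition ext_modop : modop k full.
Proof.
refine (@ModOp k full ext_smodule ext_comp ext_contr
  _ _ _ _ _ _ _ _ _ _ _ _ _ _ _).
- move=> a b c e i p q r d y t x x'; apply: value_inj => T.
  by rewrite [RHS]linearP /= !valueE linearP mcompDl mcompZl.
- move=> a b c e i p q r d x t y y'; apply: value_inj => T.
  by rewrite [RHS]linearP /= !valueE !linearP.
- move=> a b c e i p q r p' q' r' d ex ey ez dl dr x y.
  apply: value_inj => T; rewrite linearD linearZ /= !valueE.
  by rewrite (mcomp_diff e i d ex ey ez dl dr).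
- move=> a c e i j ij p t x y; apply: value_inj => T.
  by rewrite [RHS]linearP /= !valueE !linearP.
- move=> a c e i j ij p q ep x; apply: value_inj => T.
  by rewrite !valueE mcontr_diff.
- move=> a b c e i p q r d x y s t w H1 H2 H3; apply: value_inj => T.
  by rewrite !valueE (mcomp_act e d _ _ H1 H2 H3).
- move=> a c e i j p x s w ij sij H; apply: value_inj => T.
  by rewrite !valueE (mcontr_act e _ ij sij H).
- move=> a b c e e' i j p q r d d' x y s w H1 H2 H3 H4.
  apply: value_inj => T; rewrite linearZ /= !valueE.
  exact: (mcomp_comm e e' d d' _ _ H1 H2 H3 H4).
- move=> a c e i j ij ji p x; apply: value_inj => T.
  by rewrite !valueE (mcontr_sym e ij ji).
- move=> a b c ab bc abc e1 e2 e3 e4 i o o' p q r pq qr pqr d1 d2 d3 d4 x y z.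
  move=> H1 H2; apply: value_inj => T.
  by rewrite !valueE (mcomp_seq e1 e2 e3 e4 d1 d2 d3 d4 _ _ _ H1 H2).
- move=> a b c ab ac abc e1 e2 e3 e4 i j j' i' p q r pq pr pqr d1 d2 d3 d4.
  move=> x y z H1 H2 H3; apply: value_inj => T; rewrite linearZ /= !valueE.
  exact: (mcomp_par e1 e2 e3 e4 d1 d2 d3 d4 _ _ _ H1 H2 H3).
- move=> a b b' c e1 e2 e3 e4 i j m o m' o' i' j' ij mo mo' ij' p x.
  move=> H1 H2 H3 H4 H5 H6 H7 H8; apply: value_inj => T.
  by rewrite !valueE (mcontr_contr e1 e2 e3 e4 ij mo mo' ij' _ H1).
- move=> a b c a' c' e1 e2 e3 e4 i m o m' o' i' mo mo' p q r d x y.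
  move=> H1 H2 H3 H4 H5; apply: value_inj => T.
  by rewrite !valueE (mcontr_compl e1 e2 e3 e4 mo mo' d _ _ H1 H2 H3 H4 H5).
- move=> a b c b' c' e1 e2 e3 e4 i m o m' o' mo mo' p q r d x y.
  move=> H1 H2 H3 H4; apply: value_inj => T.
  by rewrite !valueE (mcontr_compr e1 e2 e3 e4 mo mo' d _ _ H1 H2 H3 H4).
- move=> a b c c' e1 e2 i m o l t m' l' i' o' ml' io' w p q r d x y.
  move=> H1 H2 H3 H4 H5 H6 H7 H8 H9 H10; apply: value_inj => T.
  rewrite !valueE.
  exact: (mcontr_compm e1 e2 ml' io' d _ _ H1 H2 H3 H4 H5 H6 H7 H8 H9 H10).
Defined.

Definition ext_base : mohom P ext_modop.
Proof.
apply: (@build_mohom k full P ext_modop (fun a p x => ext_class (TBase x))).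
- move=> a p t x y; apply: value_inj => T.
  by rewrite linearP /= !value_class /= linearP.
- move=> a p s x; apply: value_inj => T.
  by rewrite valueE !value_class /= gmap_act.
- move=> a p q e x; apply: value_inj => T.
  by rewrite valueE !value_class /= shom_diff.
- move=> a b c e i p q r d x y; apply: value_inj => T.
  by rewrite valueE !value_class /= mohom_comp.
- move=> a c e i j ij p x; apply: value_inj => T.
  by rewrite valueE !value_class /= mohom_contr.
Defined.

Definition ext_gen : gmap V (srestrict (ofdim n%:Z) ext_modop).
Proof.
apply: (@build_gmap k _ V (srestrict (ofdim n%:Z) ext_modop)
  (fun a p v => ext_class (TGen v))).
- move=> a p t x y; apply: value_inj => T.
  by rewrite linearP /= !value_class /= linearP.
- move=> a p s x; apply: value_inj => T.
  by rewrite value_act !value_class /= gmap_act.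
Defined.

Definition ext_eval (T : target) : mohom ext_modop (tgt T).
Proof.
apply: (@build_mohom k full ext_modop (tgt T) (fun a p x => value T x)).
- by move=> a p; apply: value_linear.
- by move=> a p s x; rewrite value_act.
- by move=> a p q e x; rewrite value_diff.
- by move=> a b c e i p q r d x y; rewrite value_comp.
- by move=> a c e i j ij p x; rewrite value_contr.
Defined.

Lemma class_zero a p : ext_class (TZero a p) = 0 :> ext_modop a p.
Proof. by []. Qed.
Lemma class_add a p (t u : term a p) :
  ext_class (TAdd t u) = (ext_class t : ext_modop a p) + ext_class u.
Proof. by apply: value_inj => T; rewrite [RHS]linearD /= !value_class. Qed.
Lemma class_scale a p z (t : term a p) :
  ext_class (TScale z t) = z *: (ext_class t : ext_modop a p).
Proof. by apply: value_inj => T; rewrite [RHS]linearZ /= !value_class. Qed.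
Lemma class_act a p s (t : term a p) :
  ext_class (TAct s t) = sact ext_modop s (ext_class t).
Proof. by apply: value_inj => T; rewrite value_act !value_class. Qed.
Lemma class_diff a p q (e : p = q + 1) (t : term a p) :
  ext_class (TDiff e t) = cdiff (ext_modop a) e (ext_class t).
Proof. by apply: value_inj => T; rewrite value_diff !value_class. Qed.
Lemma class_comp a b c (e : gluable a b c) i p q r (d : p + q = r)
  (t : term a p) (u : term b q) :
  ext_class (TComp e i d t u) =
  mcomp ext_modop e i d (ext_class t) (ext_class u).
Proof. by apply: value_inj => T; rewrite value_comp !value_class. Qed.
Lemma class_contr a c (e : contractible a c) i j (ij : i != j) p
  (t : term a p) :
  ext_class (TContr e ij t) = mcontr ext_modop e ij (ext_class t).
Proof. by apply: value_inj => T; rewrite value_contr !value_class. Qed.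

Lemma ext_universal : is_principal_ext xi ext_base ext_gen.
Proof.
split.
  move=> a p x; apply: value_inj => T.
  rewrite value_diff [in RHS]value_class value_class /=.
  exact: (tgt_compat T).
move=> Q f g fg; pose T := Target fg.
exists (ext_eval T); first by split=> a p x; exact: (value_class T).
move=> h hf hg a p x.
suff ht b q (t : term b q) : h b q (ext_class t) = eval T t.
  by rewrite -[x]ext_class_repr ht; apply/esym/(value_class T).
elim: t => {a p x b q}.
- by move=> a p x; apply: hf.
- by move=> a p x; apply: hg.
- by move=> a p; rewrite class_zero linear0.
- by move=> a p t ht u hu; rewrite class_add linearD /= ht hu.
- by move=> a p z t ht; rewrite class_scale linearZ /= ht.
- by move=> a p s t ht; rewrite class_act gmap_act ht.
- by move=> a p q e t ht; rewrite class_diff -shom_diff ht.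
- by move=> a b c e i p q r d t ht u hu; rewrite class_comp mohom_comp ht hu.
- by move=> a c e i j ij p t ht; rewrite class_contr mohom_contr ht.
Qed.

(** An expression of dimension [< n] cannot involve the new generators. *)
Lemma ext_base_surj (a : idx full) (p : int) (x : ext_modop a p) :
  (dim a < n)%N -> exists y : P a p, x = ext_base a p y.
Proof.
rewrite -[x]ext_class_repr; move: (ext_repr x) => {x} t.
elim: t => {a p}.
- by move=> a p x _; exists x.
- move=> a p v; have := valP a; rewrite /= (ofdim_dim n (to_full a)).
  by move=> /eqP->; rewrite ltnn.
- by move=> a p _; exists 0; rewrite class_zero linear0.
- move=> a p t ht u hu h; have [y ey] := ht h; have [z ez] := hu h.
  by exists (y + z); rewrite class_add ey ez linearD.
- move=> a p z t ht h; have [y ey] := ht h.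
  by exists (z *: y); rewrite class_scale ey linearZ.
- move=> a p s t ht h; have [y ey] := ht h.
  by exists (sact P s y); rewrite class_act ey gmap_act.
- move=> a p q e t ht h; have [y ey] := ht h.
  by exists (cdiff (P a) e y); rewrite class_diff ey shom_diff.
- move=> a b c e i p q r d t ht u hu h.
  have [y ey] := ht (gluable_ltl e h); have [z ez] := hu (gluable_ltr e h).
  by exists (mcomp P e i d y z); rewrite class_comp ey ez mohom_comp.
- move=> a c e i j ij p t ht h; have [y ey] := ht (contractible_lt e h).
  by exists (mcontr P e ij y); rewrite class_contr ey mohom_contr.
Qed.

(** In dimension [n] no operation can be applied to a new generator, apart from
    permutations and the differential, and the latter leads back to [P]. *)
Lemma ext_gen_surj (b : idx (ofdim n%:Z)) (p : int)
  (x : ext_modop (to_full b) p) :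
  exists (y : P (to_full b) p) (v : V b p),
    x = ext_base (to_full b) p y + ext_gen b p v.
Proof.
have [compat _] := ext_universal.
(* The index [a] of an expression varies in the induction, hence the
   transport along [a = to_full b]. *)
pose top (a : idx full) q (z : ext_modop a q) := forall e : a = to_full b,
  exists (y : P (to_full b) q) (v : V b q),
    eq_rect a (fun c => ext_modop c q) z _ e =
    ext_base (to_full b) q y + ext_gen b q v.
have topP q (z : ext_modop (to_full b) q) : top (to_full b) q z ->
  exists (y : P (to_full b) q) (v : V b q),
    z = ext_base (to_full b) q y + ext_gen b q v by move=> H; exact: (H erefl).
have low a q (z : ext_modop a q) : (dim a < n)%N \/
    (exists y, z = ext_base a q y) -> top a q z.
  move=> H e; have [y ->] : exists y, z = ext_base a q y.
    case: H => [|//] /ext_base_surj; exact.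
  by subst a; exists y, 0; rewrite linear0 addr0.
rewrite -[x]ext_class_repr; move: (ext_repr x) => {x} t0.
have dimb : dim (to_full b) = n.
  by have := valP b; rewrite /= (ofdim_dim n (to_full b)) => /eqP.
suff H a q (t : term a q) : top a q (ext_class t).
  exact: (H _ _ t0 erefl).
elim: t => {p t0 a q}.
- by move=> a p x; apply: low; right; exists x.
- move=> a p v e; have ab : a = b by apply: val_inj; exact: (congr1 val e).
  subst a; exists 0, v; rewrite linear0 add0r.
  by rewrite (eq_irrelevance e erefl).
- by move=> a p; apply: low; right; exists 0; rewrite class_zero linear0.
- move=> a p t ht u hu e; subst a.
  have [y [v ev]] := topP _ _ ht; have [z [w ew]] := topP _ _ hu.
  exists (y + z), (v + w); by rewrite class_add ev ew !linearD addrACA.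
- move=> a p z t ht e; subst a; have [y [v ev]] := topP _ _ ht.
  exists (z *: y), (z *: v).
  by rewrite class_scale ev !linearZ scalerDr.
- move=> a p s t ht e; subst a; have [y [v ev]] := topP _ _ ht.
  exists (sact P s y), (sact V s v).
  by rewrite class_act ev !gmap_act linearD.
- move=> a p q e t ht e'; subst a p; have [y [v ev]] := topP _ _ ht.
  exists (cdiff (P (to_full b)) erefl y + xi b q v), 0.
  rewrite class_diff ev linear0 addr0 !linearD.
  exact: congr2 (shom_diff ext_base _ y) (compat b q v).
- move=> a c d e i p q r f t _ u _ ed.
  have en : n = (dim a + dim c).+1 by rewrite -(dim_gluable e) ed dimb.
  move: (ed); apply: low; right; rewrite class_comp.
  have [y ->] : exists y, ext_class t = ext_base a p y.
    by apply: ext_base_surj; rewrite en; lia.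
  have [z ->] : exists z, ext_class u = ext_base c q z.
    by apply: ext_base_surj; rewrite en; lia.
  by exists (mcomp P e i f y z); rewrite mohom_comp.
- move=> a d e i j ij p t _ ed.
  have en : n = (dim a).+1 by rewrite -(dim_contractible e) ed dimb.
  move: (ed); apply: low; right; rewrite class_contr.
  have [y ->] : exists y, ext_class t = ext_base a p y.
    by apply: ext_base_surj; rewrite en.
  by exists (mcontr P e ij y); rewrite mohom_contr.
Qed.

End PrincipalExtension.

(** * Killing the homology of the cone *)

Section Submodule.
Variables (k : fieldType) (E : lmodType k) (S : E -> Prop).

Definition subspace : Prop :=
  S 0 /\ forall t x y, S x -> S y -> S (t *: x + y).

Definition subspace_pred of subspace : pred E := fun x => `[< S x >].

Variable H : subspace.

Lemma subspace_pred_closed : submod_closed (subspace_pred H).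
Proof.
case: H => S0 Slin; split; first exact/asboolP.
by move=> t x y /asboolP Sx /asboolP Sy; apply/asboolP/Slin.
Qed.

HB.instance Definition _ :=
  GRing.isSubmodClosed.Build k E (subspace_pred H) subspace_pred_closed.

Definition submodule : Type := {x : E | subspace_pred H x}.

HB.instance Definition _ := [isSub of submodule for @sval E _].
HB.instance Definition _ := [Choice of submodule by <:].
HB.instance Definition _ := [SubChoice_isSubLmodule of submodule by <:].

Definition in_submodule (x : E) (Sx : S x) : submodule :=
  exist _ x (introT (asboolP _) Sx).

Lemma submoduleP (x : submodule) : S (val x).
Proof. exact: elimT (asboolP _) (valP x). Qed.

End Submodule.

Definition homology_iso (k : fieldType) (P Q : modop k full) (f : mohom P Q)
  (a : idx full) (p : int) : Prop :=
  (forall x y : P a p, cycle x -> cycle y ->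
     homologous (f a p x) (f a p y) -> homologous x y) /\
  (forall y : Q a p, cycle y ->
     exists2 x : P a p, cycle x & homologous (f a p x) y).

(** The relative cycles and boundaries are those of the mapping cone of
    [f : A -> P], up to signs.  New generators [w = (y, z)] form a complement
    of the boundaries in the cycles; attaching them with [d w = y] and
    sending [w] to [z] kills the homology of the cone in dimension [n]. *)

Section Attach.
Variables (k : fieldType) (char0 : [pchar k] =i pred0) (n : nat).
Variables (A P : modop k full) (f : mohom A P).

Section Component.
Variables (a : idx full) (p : int).

Definition relative : lmodType k := (A a (p - 1) * P a p)%type.

Definition relative_act (s : {perm 'I_(legs a)}) (u : relative) : relative :=
  (sact A s u.1, sact P s u.2).

Definition relative_cycle (u : relative) : Prop :=
  (forall q (e : p - 1 = q + 1), cdiff (A a) e u.1 = 0) /\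
  (forall q (e : p = q + 1),
     cdiff (P a) e u.2 = f a q (degree_cast (pred_eq e) u.1)).

Definition relative_boundary (u : relative) : Prop :=
  exists (y : A a p) (z : P a (p + 1)),
  u = (cdiff (A a) (esym (subrK 1 p)) y, f a p y - cdiff (P a) erefl z).

Lemma relative_act_linear s : linear (relative_act s).
Proof. by move=> t u v; rewrite /relative_act pair_linE !linearP. Qed.

Lemma relative_cycle_subspace : subspace relative_cycle.
Proof.
split; first by split=> q e; rewrite !linear0.
move=> t u v [Zu Zu'] [Zv Zv']; split=> q e; rewrite !linearP /=.
  by rewrite Zu Zv scaler0 addr0.
by rewrite Zu' Zv'.
Qed.

Lemma relative_boundary_subspace : subspace relative_boundary.
Proof.
split; first by exists 0, 0; rewrite !linear0 addr0.
move=> t _ _ [y [z ->]] [y' [z' ->]]; exists (t *: y + y'), (t *: z + z').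
rewrite pair_linE; congr (_, _); first by rewrite linearP.
rewrite [f _ _ (_ + _)]linearP [cdiff _ _ (_ + _)]linearP /=.
by rewrite scalerBr opprD addrACA.
Qed.

Lemma relative_boundary_cycle u : relative_boundary u -> relative_cycle u.
Proof.
case=> y [z ->]; split=> q e; rewrite /=; first by rewrite cdiffK.
rewrite linearB /= cdiffK subr0 shom_diff.
by rewrite -(cdiff_cast (erefl p) e).
Qed.

Lemma relative_cycle_act s u :
  relative_cycle u -> relative_cycle (relative_act s u).
Proof.
case=> Z Z'; split=> q e; rewrite /= sact_diff ?Z ?linear0 //.
by rewrite Z' sact_cast gmap_act.
Qed.

Lemma relative_boundary_act s u :
  relative_boundary u -> relative_boundary (relative_act s u).
Proof.
case=> y [z ->]; exists (sact A s y), (sact P s z).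
by rewrite /relative_act /= linearB /= !sact_diff gmap_act.
Qed.

(** Characteristic zero makes the order of the symmetric group invertible. *)
Lemma relative_retraction : exists r : relative -> relative,
  [/\ linear r, forall u, relative_boundary (r u),
      forall u, relative_boundary u -> r u = u &
      forall s u, r (relative_act s u) = relative_act s (r u)].
Proof.
have [B0 Blin] := relative_boundary_subspace.
apply: equivariant_retraction => //.
- have /pcharf0P -> := char0; rewrite -lt0n.
  by apply/card_gt0P; exists 1%g.
- exact: relative_act_linear.
- by move=> [x y]; rewrite /relative_act /= !sact1.
- by move=> s t [x y]; rewrite /relative_act /= !sactM.
- exact: relative_boundary_act.
Qed.

Definition retract : relative -> relative := sval (cid relative_retraction).

Lemma retractP : [/\ linear retract, forall u, relative_boundary (retract u),
  forall u, relative_boundary u -> retract u = u &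
  forall s u, retract (relative_act s u) = relative_act s (retract u)].
Proof. by rewrite /retract; case: cid. Qed.

(** These form a complement, stable under the symmetric group, of the
    boundaries in the cycles; it represents the homology of the cone. *)
Definition reduced_cycle (u : relative) : Prop :=
  relative_cycle u /\ retract u = 0.

Lemma reduced_cycle_subspace : subspace reduced_cycle.
Proof.
have [rl rB rid _] := retractP; have [Z0 Zlin] := relative_cycle_subspace.
have [B0 _] := relative_boundary_subspace.
split; first by split; last exact: rid.
move=> t u v [Zu ru] [Zv rv]; split; first exact: Zlin.
by rewrite rl ru rv scaler0 addr0.
Qed.

Lemma reduced_cycle_act s u :
  reduced_cycle u -> reduced_cycle (relative_act s u).
Proof.
have [_ _ _ ract] := retractP; case=> Zu ru; split.
  exact: relative_cycle_act.
by rewrite ract ru /relative_act !linear0.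
Qed.

Lemma relative_cycle_split u : relative_cycle u ->
  exists w v, [/\ reduced_cycle w, relative_boundary v & u = w + v].
Proof.
have [rl rB rid _] := retractP; have [_ Zlin] := relative_cycle_subspace.
move=> Zu; exists (u - retract u), (retract u).
split=> //; last by rewrite subrK.
split; first by rewrite addrC -scaleN1r; apply/Zlin/Zu/relative_boundary_cycle.
by rewrite addrC -scaleN1r rl rid // scaleN1r addNr.
Qed.

Lemma reduced_boundary u : reduced_cycle u -> relative_boundary u -> u = 0.
Proof. by have [_ _ rid _] := retractP; case=> _ + /rid => ->. Qed.

Definition reduced : lmodType k := submodule reduced_cycle_subspace.

Definition reduced_act (s : {perm 'I_(legs a)}) (w : reduced) : reduced :=
  in_submodule _ (reduced_cycle_act s (submoduleP w)).

End Component.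

Definition reduced_complex (a : idx full) : complex k.
Proof.
refine (@Complex k (reduced a) (fun _ _ _ _ => 0) _ _) => //.
by move=> p q e t x y; rewrite scaler0 addr0.
Defined.

Definition reduced_smodule : smodule k full.
Proof.
refine (@SModule k full reduced_complex (@reduced_act) _ _ _ _).
- move=> a p s t x y; apply: val_inj; rewrite linearP.
  exact: relative_act_linear.
- move=> a p x; apply: val_inj; rewrite /= /relative_act !sact1.
  by case: (sval x).
- by move=> a p s t x; apply: val_inj; rewrite /= /relative_act !sactM.
- by move=> a p q e s x; apply: val_inj; rewrite /= /relative_act !linear0.
Defined.

Definition cells : smodule k (ofdim n%:Z) :=
  srestrict (ofdim n%:Z) reduced_smodule.

Definition cells_xi : shom (sshift cells) (srestrict (ofdim n%:Z) A).
Proof.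
pose F (a : idx (ofdim n%:Z)) p (w : sshift cells a p) : A (to_full a) p :=
  degree_cast (addrK 1 p) (val (w : reduced (to_full a) (p + 1))).1.
apply: (@build_shom k _ (sshift cells) (srestrict (ofdim n%:Z) A) F).
- by move=> a p t x y; rewrite /F !linearP.
- by move=> a p s x; rewrite /F -sact_cast.
- move=> a p q e x; rewrite /= /F.
  have [[Z _] _] := submoduleP (x : reduced (to_full a) (p + 1)).
  rewrite (cdiff_cast _ e (etrans (addrK 1 p) e) erefl) Z.
  by rewrite /= /shift_diff /= oppr0 !linear0.
Defined.

Definition cells_map : gmap cells (srestrict (ofdim n%:Z) P).
Proof.
by apply: (@build_gmap k _ cells (srestrict (ofdim n%:Z) P)
  (fun a p w => (val (w : reduced (to_full a) p)).2)).
Defined.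

Lemma cells_compat : pair_compat cells_xi f cells_map.
Proof.
move=> a p w; have [[_ Z] _] := submoduleP (w : reduced (to_full a) (p + 1)).
rewrite [LHS]Z; congr (f _ _ (degree_cast _ _)).
exact: eq_irrelevance.
Qed.

(** By [bsurj], [gsurj] and [inj], an element of [X] in dimension [n] is
    [j y + gamma w], and it is a cycle exactly when [d y] and the boundary
    [xi w] cancel in [A].  Surjectivity in homology: a cycle [y] of [P] gives
    the relative cycle [(0, y)], and its decomposition into a generator and a
    relative boundary is a cycle of [X] above [y].  Injectivity: if the image
    of the cycle [j y + gamma w] is [d z], then [w] is a relative boundary,
    hence 0; so [(y, z)] is a relative cycle and its decomposition exhibits
    [j y] as a boundary. *)
Lemma attach_cells : exists (X : modop k full) (j : mohom A X) (h : mohom X P),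
  [/\ principal_map n%:Z j,
      forall a p (x : A a p), h a p (j a p x) = f a p x,
      forall a p (x : X a p), (dim a < n)%N -> exists y, x = j a p y &
      forall a p, dim a = n -> homology_iso h a p].
Proof.
pose X := ext_modop cells_xi; pose j : mohom A X := ext_base cells_xi.
pose gamma : gmap cells (srestrict (ofdim n%:Z) X) := ext_gen cells_xi.
have [compat univ] : is_principal_ext cells_xi j gamma.
  exact: ext_universal.
have [snd_of sndE snd_compat] :
    exists2 g : gmap cells (srestrict (ofdim n%:Z) P),
      forall a q (w : cells a q), g a q w = (val (w : reduced (to_full a) q)).2
    & pair_compat cells_xi f g.
  by exists cells_map => //; exact: cells_compat.
have [h [hj hg] _] := univ _ _ _ snd_compat.
have pm : principal_map n%:Z j.
  by exists cells, cells_xi, gamma; split=> //; exact: ext_universal.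
have bsurj a p (x : X a p) : (dim a < n)%N -> exists y, x = j a p y.
  exact: ext_base_surj.
have gsurj b p (x : X (to_full b) p) :
  exists y w, x = j (to_full b) p y + gamma b p w.
  exact: ext_gen_surj.
exists X, j, h; split=> //; clear univ; clearbody gamma j X.
move=> a0 p dim_a.
have [a Ea] : exists a : idx (ofdim n%:Z), a0 = to_full a.
  by apply: to_fullP; rewrite ofdim_dim dim_a.
subst a0.
pose fst_of q (w : cells a q) : A (to_full a) (q - 1) :=
  (val (w : reduced (to_full a) q)).1.
have dgamma q r (e : q = r + 1) (w : cells a q) :
  cdiff (X (to_full a)) e (gamma a q w) =
  j (to_full a) r (degree_cast (pred_eq e) (fst_of q w)).
  move: (e) w; rewrite e => {e} e w; rewrite (eq_irrelevance e erefl).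
  rewrite (compat a r w); congr (j _ _ (degree_cast _ _)).
  exact: eq_irrelevance.
have split q (y : A (to_full a) (q - 1)) (z : P (to_full a) q) :
    relative_cycle ((y, z) : relative _ _) ->
    exists (w : cells a q) (y' : A (to_full a) q) z',
      y = fst_of q w + cdiff (A (to_full a)) (esym (subrK 1 q)) y' /\
      z = snd_of a q w + (f (to_full a) q y' - cdiff (P (to_full a)) erefl z').
  move/relative_cycle_split=> [w [_ [wr [y' [z' ->]] [-> ->]]]].
  by exists (in_submodule _ wr), y', z'; rewrite sndE.
have castd q r (e : q = r + 1) (y : A (to_full a) q) :
    degree_cast (pred_eq e) (cdiff (A (to_full a)) (esym (subrK 1 q)) y) =
    cdiff (A (to_full a)) e y.
  by rewrite -(cdiff_cast (erefl q) e).
have inj x : j (to_full a) (p - 1) x = 0 -> x = 0.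
  by apply: principal_map_inj pm _; rewrite dim_a.
split=> [x x' cx cx' [z ez]|y cy].
  set v := x - x'.
  have cv q (e : p = q + 1) : cdiff (X (to_full a)) e v = 0.
    by rewrite linearB /= cx cx' subrr.
  have hv : h (to_full a) p v = cdiff (P (to_full a)) erefl z.
    by rewrite linearB.
  have [y [w ev]] := gsurj a p v.
  have w1 : fst_of p w = - cdiff (A (to_full a)) (esym (subrK 1 p)) y.
    have := cv _ (esym (subrK 1 p)); rewrite ev linearD /= dgamma shom_diff.
    rewrite -linearD /= => /inj; rewrite degree_cast_id => /eqP.
    by rewrite addr_eq0 => /eqP ->; rewrite opprK.
  have w2 : snd_of a p w =
      cdiff (P (to_full a)) erefl z - f (to_full a) p y.
    by rewrite -hv ev linearD /= hj hg addrC addKr.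
  have w0 : w = 0.
    apply: val_inj.
    apply: (reduced_boundary (submoduleP (w : reduced (to_full a) p))).
    exists (- y), (- z); rewrite !linearN /= opprK.
    apply: injective_projections; first exact: w1.
    apply: etrans (esym (sndE a p w)) _; rewrite w2; exact: addrC.
  move: ev w1 w2; rewrite w0 !linear0 addr0 => ev dy fy.
  have cyc : relative_cycle ((degree_cast (esym (addrK 1 p)) y, z) :
      relative (to_full a) (p + 1)).
    split=> q e /=.
      have e4 : p - 1 = q := pred_eq (etrans (esym (addrK 1 p)) e).
      rewrite (cdiff_cast _ _ (esym (subrK 1 p)) e4).
      by move/eqP: dy; rewrite eq_sym oppr_eq0 => /eqP->; rewrite linear0.
    have eqp : p = q by move/addIr: e.
    rewrite (degree_cast_cast _ _ eqp); subst q; rewrite degree_cast_id.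
    rewrite (cdiff_irr e erefl).
    by move/eqP: fy; rewrite eq_sym subr_eq0 => /eqP.
  have [w' [y' [z' [ey _]]]] := split _ _ _ cyc.
  exists (gamma a (p + 1) w' + j (to_full a) (p + 1) y').
  rewrite linearD /= dgamma shom_diff -linearD /= -/v ev; congr (j _ _ _).
  by rewrite -castd -linearD /= -ey (degree_cast_cast _ _ (erefl p)).
have cyc : relative_cycle ((0, y) : relative (to_full a) p).
  by split=> q e /=; rewrite !linear0 // cy.
have [w [y' [z' [e1 e2]]]] := split _ _ _ cyc.
exists (gamma a p w + j (to_full a) p y').
  move=> q e; rewrite linearD /= dgamma shom_diff -linearD /= -castd.
  by rewrite -linearD /= -e1 !linear0.
exists z'; rewrite linearD /= hj hg [in LHS]e2.
by rewrite [X in - X]addrA opprD opprK addrA subrr add0r.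
Qed.

End Attach.

(** * The colimit of a tower *)

Section Tower.
Variables (k : fieldType) (N : nat -> modop k full).
Variable j : forall n, mohom (N n) (N n.+1).

Definition stage_cast (m n : nat) (e : m = n) : mohom (N m) (N n) :=
  eq_rect m (fun i => mohom (N m) (N i)) (mohom_id (N m)) n e.

(** This is a composite of the maps [j] when [m <= n], and 0 otherwise: being
    defined for all [m] and [n], it takes no proof as argument. *)
Fixpoint trans (m n : nat) : mohom (N m) (N n) :=
  if m =P n is ReflectT e then stage_cast e else
  if n is n'.+1 return mohom (N m) (N n)
  then mohom_compose (j n') (trans m n') else mohom0 (N m) (N 0).

Lemma trans_id (n : nat) (a : idx full) (p : int) (x : N n a p) :
  trans n n a p x = x.
Proof.
by case: n x => [|n] x /=; case: eqP => // e; rewrite (eq_irrelevance e erefl).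
Qed.

Lemma transS (m n : nat) (a : idx full) (p : int) (x : N m a p) :
  (m <= n)%N -> trans m n.+1 a p x = j n a p (trans m n a p x).
Proof. by move=> mn /=; case: eqP => // e; rewrite e ltnn in mn. Qed.

Lemma trans_trans (l m n : nat) (a : idx full) (p : int) (x : N l a p) :
  (l <= m)%N -> (m <= n)%N ->
  trans m n a p (trans l m a p x) = trans l n a p x.
Proof.
move=> lm; elim: n => [|n IHn].
  by rewrite leqn0 => /eqP e; subst m; rewrite trans_id.
rewrite leq_eqVlt => /orP[/eqP e|mn]; first by subst m; rewrite trans_id.
by rewrite !transS ?IHn //; apply: leq_trans lm mn.
Qed.

Lemma trans_map (Q : modop k full) (f : forall n, mohom (N n) Q)
  (fj : forall n a p (x : N n a p), f n.+1 a p (j n a p x) = f n a p x)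
  (m n : nat) (a : idx full) (p : int) (x : N m a p) :
  (m <= n)%N -> f n a p (trans m n a p x) = f m a p x.
Proof.
elim: n => [|n IHn].
  by rewrite leqn0 => /eqP e; subst m; rewrite trans_id.
rewrite leq_eqVlt => /orP[/eqP e|mn]; first by subst m; rewrite trans_id.
by rewrite transS // fj IHn.
Qed.

(** A component of dimension [d] no longer changes after stage [d + 1], so the
    colimit is given by these stable values.  To operate on elements, first
    bring them to the stage of the result. *)
Definition colim_comp (a b c : idx full) (e : gluable a b c)
  (i : 'I_(legs a)) (p q r : int) (d : p + q = r)
  (x : N (dim a).+1 a p) (y : N (dim b).+1 b q) : N (dim c).+1 c r :=
  mcomp (N (dim c).+1) e i d (trans _ _ a p x) (trans _ _ b q y).

Definition colim_contr (a c : idx full) (e : contractible a c)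
  (i j : 'I_(legs a)) (ij : i != j) (p : int) (x : N (dim a).+1 a p) :
  N (dim c).+1 c p := mcontr (N (dim c).+1) e ij (trans _ _ a p x).

Definition colim_smodule : smodule k full :=
  @SModule k full (fun a => N (dim a).+1 a)
    (fun a p => @sact k full (N (dim a).+1) a p)
    (fun a p => @sact_linear k full (N (dim a).+1) a p)
    (fun a p => @sact1 k full (N (dim a).+1) a p)
    (fun a p => @sactM k full (N (dim a).+1) a p)
    (fun a p q e => @sact_diff k full (N (dim a).+1) a p q e).

Let leql (a b c : idx full) (e : gluable a b c) :
  ((dim a).+1 <= (dim c).+1)%N :=
  gluable_ltl e (ltnSn _).
Let leqr (a b c : idx full) (e : gluable a b c) :
  ((dim b).+1 <= (dim c).+1)%N :=
  gluable_ltr e (ltnSn _).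
Let leqc (a c : idx full) (e : contractible a c) :
  ((dim a).+1 <= (dim c).+1)%N :=
  contractible_lt e (ltnSn _).

Definition colim : modop k full.
Proof.
refine (@ModOp k full colim_smodule colim_comp colim_contr
  _ _ _ _ _ _ _ _ _ _ _ _ _ _ _); rewrite /colim_comp /colim_contr.
- by move=> a b c e i p q r d y t x x'; rewrite linearP mcompDl mcompZl.
- by move=> a b c e i p q r d x t y y'; rewrite !linearP.
- move=> a b c e i p q r p' q' r' d ex ey ez dl dr x y.
  by rewrite (mcomp_diff e i d ex ey ez dl dr) !shom_diff.
- by move=> a c e i i' ij p t x y; rewrite !linearP.
- by move=> a c e i i' ij p q ep x; rewrite mcontr_diff shom_diff.
- move=> a b c e i p q r d x y s t w H1 H2 H3; rewrite !gmap_act.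
  exact: (mcomp_act e d _ _ H1 H2 H3).
- move=> a c e i i' p x s w ij sij H; rewrite !gmap_act.
  exact: (mcontr_act e _ ij sij H).
- move=> a b c e e' i i' p q r d d' x y s w H1 H2 H3 H4; rewrite !gmap_act.
  exact: (mcomp_comm e e' d d' _ _ H1 H2 H3 H4).
- by move=> a c e i i' ij ji p x; apply: mcontr_sym.
- move=> a b c ab bc abc e1 e2 e3 e4 i o o' p q r pq qr pqr d1 d2 d3 d4 x y z.
  move=> H1 H2; rewrite !mohom_comp !trans_trans ?(leql e1) ?(leql e2)
    ?(leql e3) ?(leql e4) ?(leqr e1) ?(leqr e2) ?(leqr e3) ?(leqr e4) //.
  exact: (mcomp_seq e1 e2 e3 e4 d1 d2 d3 d4 _ _ _ H1 H2).
- move=> a b c ab ac abc e1 e2 e3 e4 i i' j' i'' p q r pq pr pqr d1 d2 d3 d4.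
  move=> x y z H1 H2 H3; rewrite !mohom_comp !trans_trans ?(leql e1) ?(leql e2)
    ?(leql e3) ?(leql e4) ?(leqr e1) ?(leqr e2) ?(leqr e3) ?(leqr e4) //.
  exact: (mcomp_par e1 e2 e3 e4 d1 d2 d3 d4 _ _ _ H1 H2 H3).
- move=> a b b' c e1 e2 e3 e4 i i1 m o m' o' i' j' ij mo mo' ij' p x.
  move=> H1 H2 H3 H4 H5 H6 H7 H8; rewrite !mohom_contr !trans_trans
    ?(leqc e1) ?(leqc e2) ?(leqc e3) ?(leqc e4) //.
  exact: (mcontr_contr e1 e2 e3 e4 ij mo mo' ij' _ H1).
- move=> a b c a' c' e1 e2 e3 e4 i m o m' o' i' mo mo' p q r d x y.
  move=> H1 H2 H3 H4 H5; rewrite !(mohom_comp, mohom_contr) !trans_trans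
    ?(leqc e2) ?(leqc e3) ?(leql e1) ?(leqr e1) ?(leql e4) ?(leqr e4) //.
  exact: (mcontr_compl e1 e2 e3 e4 mo mo' d _ _ H1 H2 H3 H4 H5).
- move=> a b c b' c' e1 e2 e3 e4 i m o m' o' mo mo' p q r d x y.
  move=> H1 H2 H3 H4; rewrite !(mohom_comp, mohom_contr) !trans_trans
    ?(leqc e2) ?(leqc e3) ?(leql e1) ?(leqr e1) ?(leql e4) ?(leqr e4) //.
  exact: (mcontr_compr e1 e2 e3 e4 mo mo' d _ _ H1 H2 H3 H4).
- move=> a b c c' e1 e2 i m o l t m' l' i' o' ml' io' w p q r d x y.
  move=> H1 H2 H3 H4 H5 H6 H7 H8 H9 H10.
  rewrite !mohom_comp !trans_trans ?(leql e1) ?(leqr e1) ?(leqc e2) //.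
  rewrite !gmap_act.
  exact: (mcontr_compm e1 e2 ml' io' d _ _ H1 H2 H3 H4 H5 H6 H7 H8 H9 H10).
Defined.

Definition colim_map (Q : modop k full) (f : forall n, mohom (N n) Q)
  (fj : forall n a p (x : N n a p), f n.+1 a p (j n a p x) = f n a p x) :
  mohom colim Q.
Proof.
apply: (@build_mohom k full colim Q (fun a p x => f (dim a).+1 a p x)).
- by move=> a p; exact: (@gmap_linear _ _ _ _ (f (dim a).+1) a p).
- by move=> a p s x; exact: (@gmap_act _ _ _ _ (f (dim a).+1) a p).
- by move=> a p q e x; exact: (@shom_diff _ _ _ _ (f (dim a).+1) a p).
- move=> a b c e i p q r d x y; rewrite [LHS]mohom_comp.
  by rewrite !(trans_map fj) ?(leql e) ?(leqr e).
- move=> a c e i i' ij p x; rewrite [LHS]mohom_contr.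
  by rewrite (trans_map fj) ?(leqc e).
Defined.

Definition to_stage (n : nat) (a : idx full) (p : int) (x : colim a p) :
  N n a p := trans (dim a).+1 n a p x.

Lemma to_stage_below (n : nat) : hom_below n (@to_stage n).
Proof.
split.
- by move=> a p _; exact: (@gmap_linear _ _ _ _ (trans (dim a).+1 n) a p).
- by move=> a p s x _; exact: (@gmap_act _ _ _ _ (trans (dim a).+1 n) a p).
- move=> a p q e x _.
  exact: (@shom_diff _ _ _ _ (trans (dim a).+1 n) a p).
- move=> a b c e i p q r d x y h; rewrite /to_stage [LHS]mohom_comp.
  by rewrite !trans_trans ?(leql e) ?(leqr e).
- move=> a c e i i' ij p x h; rewrite /to_stage [LHS]mohom_contr.
  by rewrite !trans_trans ?(leqc e).
Qed.

Section Truncation.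
Variables (n : nat) (m : int) (Hm : m = n%:Z - 1).

Let lt_upto (a : idx (upto m)) : (dim (to_full a) < n)%N.
Proof. by rewrite -(upto_dim (to_full a) Hm); apply: (valP a). Qed.

Definition unit_map : mohom (trunc m colim) (trunc m (N n)).
Proof.
apply: (@build_mohom k _ (trunc m colim) (trunc m (N n))
  (fun a p x => @to_stage n (to_full a) p x)).
- by move=> a p; exact: (below_linear (to_stage_below n) (lt_upto a)).
- move=> a p s x.
  exact: (@below_act _ _ _ _ _ (to_stage_below n) (to_full a)
            p s x (lt_upto a)).
- move=> a p q e x.
  exact: (@below_diff _ _ _ _ _ (to_stage_below n) (to_full a)
            p q e x (lt_upto a)).
- move=> a b c e i p q r d x y.
  exact: (@below_comp _ _ _ _ _ (to_stage_below n)
            (to_full a) (to_full b) (to_full c) e i p q r d x y (lt_upto c)).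
- move=> a c e i i' ij p x.
  exact: (@below_contr _ _ _ _ _ (to_stage_below n) (to_full a) (to_full c)
            e i i' ij p x (lt_upto c)).
Defined.

Lemma unit_mapE (a : idx (upto m)) (p : int) (x : colim (to_full a) p) :
  unit_map a p x = to_stage n x.
Proof. by []. Qed.

Hypothesis to_stage_inj : forall (a : idx full) (p : int) (x y : colim a p),
  (dim a < n)%N -> to_stage n x = to_stage n y -> x = y.
Hypothesis to_stage_surj : forall (a : idx full) (p : int) (y : N n a p),
  (dim a < n)%N -> exists x, y = to_stage n x.

(** A morphism on a truncation of the colimit is a partial morphism on the
    stage [n], since both agree in dimensions [< n]. *)

Section Extension.
Variables (Q : modop k full) (phi : mohom (trunc m colim) (trunc m Q)).

Lemma to_fullK (a : idx full) (h : upto m (val a)) :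
  to_full (exist (fun b => upto m b) (val a) h) = a.
Proof. exact: val_inj. Qed.

Definition extend (a : idx full) (p : int) (x : colim a p) : Q a p :=
  match pselect (upto m (val a)) with
  | left h => eq_rect _ (fun c => colim c p -> Q c p)
                   (phi (exist (fun b => upto m b) (val a) h) p) _
                   (to_fullK h) x
  | right _ => 0
  end.

Lemma extendE (b : idx (upto m)) (p : int) (x : colim (to_full b) p) :
  extend x = phi b p x.
Proof.
rewrite /extend; case: pselect => [h|]; last by case; exact: (valP b).
move: (to_fullK h); case: b x h => v hv x /= h.
by rewrite (bool_irrelevance h hv) => e; rewrite (eq_irrelevance e erefl).
Qed.

Definition stage_extend (a : idx full) (p : int) (y : N n a p) : Q a p :=
  if pselect (exists x, y = to_stage n x) is left h then extend (sval (cid h))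
  else 0.

Lemma stage_extendE (b : idx (upto m)) (p : int) (x : colim (to_full b) p) :
  stage_extend (to_stage n x) = phi b p x.
Proof.
rewrite /stage_extend; case: pselect => [h|[]]; last by exists x.
by case: cid => x' /= /to_stage_inj -> //; rewrite extendE.
Qed.

Lemma stage_extend_below : hom_below n stage_extend.
Proof.
have H := to_stage_below n.
have up a : (dim a < n)%N -> exists b : idx (upto m), a = to_full b.
  by move=> h; apply: to_fullP; rewrite (upto_dim a Hm).
split.
- move=> a p h t y y'; have [b eb] := up a h; subst a.
  have [x ->] := to_stage_surj y h; have [x' ->] := to_stage_surj y' h.
  by rewrite -(below_linear H h) !stage_extendE linearP.
- move=> a p s y h; have [b eb] := up a h; subst a.
  have [x ->] := to_stage_surj y h.
  by rewrite -(below_act H) // !stage_extendE; exact: (gmap_act phi).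
- move=> a p q e y h; have [b eb] := up a h; subst a.
  have [x ->] := to_stage_surj y h.
  rewrite (below_diff H e x h) !stage_extendE.
  exact: (@shom_diff _ _ _ _ phi b p q e).
- move=> a b c e i p q r d y y' h.
  have ha := gluable_ltl e h; have hb := gluable_ltr e h.
  have [a' ea] := up a ha; have [b' eb] := up b hb; have [c' ec] := up c h.
  subst a b c; have [x ->] := to_stage_surj y ha.
  have [x' ->] := to_stage_surj y' hb.
  rewrite -(below_comp H) // !stage_extendE.
  exact: (@mohom_comp _ _ _ _ phi a' b' c' e).
- move=> a c e i i' ij p y h; have ha := contractible_lt e h.
  have [a' ea] := up a ha; have [c' ec] := up c h.
  subst a c; have [x ->] := to_stage_surj y ha.
  rewrite -(below_contr H) // !stage_extendE.
  exact: (@mohom_contr _ _ _ _ phi a' c' e).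
Qed.

End Extension.

Lemma unit_map_tshriek : gen_below n (N n) -> is_tshriek unit_map.
Proof.
move=> gN Q phi; have [h hF huniq] := gN _ _ (stage_extend_below phi).
exists h => [a p x|h' h'E].
  by rewrite unit_mapE hF ?lt_upto // stage_extendE.
apply: huniq => a p y ha.
have [b eb] : exists b : idx (upto m), a = to_full b.
  by apply: to_fullP; rewrite (upto_dim a Hm).
subst a; have [x ->] := to_stage_surj y ha.
by rewrite stage_extendE -(h'E b p x).
Qed.

End Truncation.

Lemma unit_map_tower (n : nat) (e : n%:Z - 1 = n%:Z - 1)
  (e' : n%:Z = n.+1%:Z - 1) : is_tower_map (unit_map e) (unit_map e') (j n).
Proof.
move=> a p x; rewrite !unit_mapE /to_stage.
have lt : (dim (to_full a) < n)%N.
  by rewrite -(upto_dim (to_full a) e); apply: (valP a).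
by rewrite -[LHS]transS.
Qed.

Hypothesis j_principal : forall n, principal_map n%:Z (j n).
Hypothesis j_surj : forall n a p (x : N n.+1 a p), (dim a < n)%N ->
  exists y, x = j n a p y.

(** The transition maps from stage [l] are bijective in dimensions [< l]. *)
Lemma trans_inj (l n : nat) (a : idx full) (p : int) (x : N l a p) :
  (dim a < l)%N -> (l <= n)%N -> trans l n a p x = 0 -> x = 0.
Proof.
move=> al; elim: n => [|n IHn]; first by rewrite leqn0 => /eqP e; subst l.
rewrite leq_eqVlt => /orP[/eqP e|ln]; first by subst l; rewrite trans_id.
rewrite transS // => /(principal_map_inj (j_principal n)) e.
by apply: IHn => //; apply: e; lia.
Qed.

Lemma trans_surj (l n : nat) (a : idx full) (p : int) (y : N n a p) :
  (dim a < l)%N -> (l <= n)%N -> exists x, y = trans l n a p x.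
Proof.
move=> al; elim: n y => [|n IHn] y; first by rewrite leqn0 => /eqP e; subst l.
rewrite leq_eqVlt => /orP[/eqP e|ln].
  by subst l; exists y; rewrite trans_id.
have [z ->] : exists z, y = j n a p z by apply: j_surj; lia.
by have [x ->] := IHn z ln; exists x; rewrite transS.
Qed.

Lemma colim_minimal (gen0 : gen_below 0 (N 0)) : minimal colim.
Proof.
have gen n : gen_below n (N n).
  by elim: n => // n /principal_gen_below; apply; exact: j_principal.
have inj n a p (x y : colim a p) :
    (dim a < n)%N -> to_stage n x = to_stage n y -> x = y.
  move=> h e; apply/eqP; rewrite -subr_eq0; apply/eqP.
  apply: (@trans_inj _ n) => //.
  by rewrite linearB /= -!/(to_stage _ _) e subrr.
have surj n a p (y : N n a p) : (dim a < n)%N -> exists x, y = to_stage n x.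
  by move=> h; apply: trans_surj.
move=> n; have e' : n%:Z = n.+1%:Z - 1 by lia.
exists (N n), (N n.+1), (unit_map (erefl (n%:Z - 1))), (unit_map e'), (j n).
split=> //.
- by apply: unit_map_tshriek => //; [exact: inj | exact: surj].
- by apply: unit_map_tshriek => //; [exact: inj | exact: surj].
- exact: unit_map_tower.
Qed.

End Tower.

(** * Minimal models *)

Theorem theorem8p6p3 (k : fieldType) (char0 : [pchar k] =i pred0)
    (P : modop k full) :
  exists (Pinf : modop k full) (f : mohom Pinf P),
    minimal Pinf /\ weak_equiv f.
Proof.
pose over := {A : modop k full & mohom A P}.
pose attaches n (S T : over) (j : mohom (tag S) (tag T)) :=
  [/\ principal_map n%:Z j,
      forall a p (x : tag S a p), tagged T a p (j a p x) = tagged S a p x,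
      forall a p (x : tag T a p), (dim a < n)%N -> exists y, x = j a p y &
      forall a p, dim a = n -> homology_iso (tagged T) a p].
have next_ex n (S : over) : exists T : {T : over & mohom (tag S) (tag T)},
    attaches n S (tag T) (tagged T).
  have [X [j [h H]]] := attach_cells char0 n (tagged S).
  by exists (existT _ (existT _ X h) j).
pose next n S := sval (cid (next_ex n S)).
have nextP n S : attaches n S (tag (next n S)) (tagged (next n S)).
  by rewrite /next; case: cid.
pose stage := fix stage n : over :=
  if n is n'.+1 then tag (next n' (stage n'))
  else existT _ (zero_modop k) (mohom0 _ _).
pose N n := tag (stage n); pose f n : mohom (N n) P := tagged (stage n).
pose j n : mohom (N n) (N n.+1) := tagged (next n (stage n)).
have jP n : attaches n (stage n) (stage n.+1) (j n) by apply: nextP.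
have fj n a p (x : N n a p) : f n.+1 a p (j n a p x) = f n a p x.
  by have [_ + _ _] := jP n; apply.
exists (colim j), (colim_map fj); split.
  apply: colim_minimal => [n|n a p x|]; last exact: zero_modop_gen_below.
    by have [] := jP n.
  by have [_ _ + _] := jP n; apply.
move=> a p; have [_ _ _ /(_ a p erefl)] := jP (dim a).
exact.
Qed.
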